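(* Let $r,k$ be positive integers and $x$ an indeterminate. For $\tilde\pi\in\tilde\Pi_{2(r),k}$ whose unbarred entries have multiplicity given by $\boldsymbol{a}\in W_{r,k}$, write $$\omega(\tilde\pi)=\frac{m(\tilde\pi)!}{|\mathfrak{S}_{\boldsymbol{a}}|}\prod_{\tilde B\in\tilde\pi}m(\tilde B|_{[\bar k]})!.$$ Then the $\mathbb{C}(x)$-linear map $$\varphi:\tilde P_{r,k}(x)\to\mathrm{MP}_{r,k}(x),\qquad \mathcal{O}_{\tilde\pi}\mapsto\omega(\tilde\pi)\mathcal{X}_{\tilde\pi},$$ where $\{\mathcal{X}_{\tilde\pi}:\tilde\pi\in\tilde\Pi_{2(r),k}\}$ is the orbit basis of Orellana and Zabrocki, is an isomorphism of algebras.
   Context: **Partition algebra.** $[r]=\{1,\dots,r\}$, $[\bar r]=\{\bar1,\dots,\bar r\}$; $\Pi_{2(r)}$ is the set of set partitions of $[r]\cup[\bar r]$. $P_r(x)$ is the $\mathbb{C}(x)$-algebra with diagram basis $\{\mathcal{L}_\pi:\pi\in\Pi_{2(r)}\}$ and product $\mathcal{L}_\pi\mathcal{L}_\nu=x^{c}\mathcal{L}_\gamma$: place the diagram of $\pi$ (top row $1,\dots,r$, bottom row $\bar1,\dots,\bar r$) above that of $\nu$, identify bottom vertex $\bar i$ of $\pi$ with top vertex $i$ of $\nu$; $\gamma$ is the resulting connectivity of the very top and very bottom, $c$ the number of components entirely in the middle. The orbit basis $\{\mathcal{T}_\pi\}$ is determined by $\mathcal{L}_\pi=\sum_{\nu\le\pi}\mathcal{T}_\nu$,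 the sum being over coarsenings $\nu$ of $\pi$ (obtained by merging blocks), $\pi$ included. For $\sigma\in\mathfrak{S}_r$, $\mathcal{L}_\sigma$ is the basis element of $\{\{\sigma(1),\bar1\},\dots,\{\sigma(r),\bar r\}\}$. $W_{r,k}$ is the set of sequences of $k$ non-negative integers with sum $r$; $\mathfrak{S}_{\boldsymbol{a}}\subseteq\mathfrak{S}_r$ is the Young subgroup permuting separately the consecutive intervals of lengths $\boldsymbol{a}_1,\dots,\boldsymbol{a}_k$; $s_{\boldsymbol{a}}=\frac1{|\mathfrak{S}_{\boldsymbol{a}}|}\sum_{\sigma\in\mathfrak{S}_{\boldsymbol{a}}}\mathcal{L}_\sigma$. $\tilde P_{r,k}(x)=\bigoplus_{\boldsymbol{a},\boldsymbol{b}\in W_{r,k}}s_{\boldsymbol{a}}P_r(x)s_{\boldsymbol{b}}$ (external direct sum), with $(s_{\boldsymbol{a}}\varphi s_{\boldsymbol{b}})\cdot(s_{\boldsymbol{c}}\psi s_{\boldsymbol{d}})=\delta_{\boldsymbol{b},\boldsymbol{c}}s_{\boldsymbol{a}}\varphi s_{\boldsymbol{b}}\psi s_{\boldsymbol{d}}$. **Multiset partitions.** $\tilde\Pi_{2(r),k}$ is the set of multiset partitions (multisets of nonempty multisets, called blocks) with $r$ elements from $[k]$ and $r$ from $[\bar k]$ in total. $\kappa_{\boldsymbol{a},\boldsymbol{b}}:\Pi_{2(r)}\to\tilde\Pi_{2(r),k}$ replaces each unbarred $i$ by the index $j$ of the consecutive interval of lengths $\boldsymbol{a}_1,\dots,\boldsymbol{a}_k$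 containing $i$, and each $\bar i$ by $\bar j$ with $j$ the index of the interval of lengths $\boldsymbol{b}_1,\dots,\boldsymbol{b}_k$ containing $i$. For $\tilde\pi$ with unbarred/barred multiplicities $\boldsymbol{a}$/$\boldsymbol{b}$, $\mathcal{O}_{\tilde\pi}=s_{\boldsymbol{a}}\mathcal{T}_\pi s_{\boldsymbol{b}}$ for any $\pi$ with $\kappa_{\boldsymbol{a},\boldsymbol{b}}(\pi)=\tilde\pi$ (the orbit-like basis of $\tilde P_{r,k}(x)$). For a multiset $\tilde S$ (of elements, or of blocks), $m(\tilde S)!$ is the product over distinct members of $\tilde S$ of the factorials of their multiplicities ($1$ if empty). $\tilde B|_R$ keeps only the elements of $\tilde B$ in $R$; for a multiset partition, $\tilde\rho|_R$ restricts every block to $R$ and discards empty results. In $\omega(\tilde\pi)$ the product is over blocks of $\tilde\pi$ with multiplicity. $\ell(\cdot)$ is the number of blocks counted with multiplicity; $(a)_n=a(a-1)\cdots(a-n+1)$. **The algebra $\mathrm{MP}_{r,k}(x)$** is the $\mathbb{C}(x)$-algebra with basis $\{\mathcal{X}_{\tilde\pi}:\tilde\pi\in\tilde\Pi_{2(r),k}\}$ and product $$\mathcal{X}_{\tilde\pi}\mathcal{X}_{\tilde\nu}=\sum_{\tilde\gamma\in\tilde\Gamma^{\tilde\pi}_{\tilde\nu}}a_{\tilde\gamma}\,\tilde b_{\tilde\gamma}(x)\,\mathcal{X}_{\tilde\gamma},$$ where $\tilde\Gamma^{\tilde\pi}_{\tilde\nu}$ is the set of multiset partitions $\tilde\gamma$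 with $r$ elements each from $[k]$, $[\bar k]$, $[\bar{\bar k}]$ (double-barred) such that $\tilde\gamma|_{[k]\cup[\bar k]}=\tilde\pi$ and $\tilde\gamma|_{[\bar k]\cup[\bar{\bar k}]}=\bar{\tilde\nu}$ ($\tilde\nu$ with a bar added to every element); in $\mathcal{X}_{\tilde\gamma}$ the index means $\tilde\gamma|_{[k]\cup[\bar{\bar k}]}$ with one bar removed from each double-barred element. With $\beta_{\tilde\gamma}$ the multiset of blocks of $\tilde\gamma$ containing only barred (from $[\bar k]$) elements, $$\tilde b_{\tilde\gamma}(x)=\frac{(x-\ell(\tilde\gamma|_{[k]\cup[\bar{\bar k}]}))_{\ell(\beta_{\tilde\gamma})}}{m(\beta_{\tilde\gamma})!},\qquad a_{\tilde\gamma}=\prod_{\tilde S}\frac{\ell(\tilde\gamma_{\tilde S})!}{m(\tilde\gamma_{\tilde S})!},$$ the product being over distinct blocks $\tilde S$ of $\tilde\gamma|_{[k]\cup[\bar{\bar k}]}$, and $\tilde\gamma_{\tilde S}$ the multiset of blocks $\tilde T\in\tilde\gamma$ with $\tilde T|_{[k]\cup[\bar{\bar k}]}=\tilde S$. *)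

(* Defs.v *)
From HB Require Import structures.
From mathcomp Require Import all_boot all_order all_fingroup all_algebra.
From mathcomp Require Import finmap multiset.
From mathcomp Require Import reals complex.
Set Implicit Arguments.
Unset Strict Implicit.
Unset Printing Implicit Defensive.
Import GRing.Theory.
Local Open Scope ring_scope.
Local Open Scope mset_scope.

(* The vertex (ord0, i) is i and (ord_max, i) is i-bar; indices start at 0. *)
Record setpart (r : nat) := SetPart {
  blocks :> {set {set 'I_2 * 'I_r}};
  _ : partition blocks [set: 'I_2 * 'I_r]
}.
HB.instance Definition _ r := [isSub for @blocks r].
HB.instance Definition _ r := [Finite of setpart r by <:].

Lemma setpartP r (p : setpart r) : partition p [set: 'I_2 * 'I_r].
Proof. exact: (valP p). Qed.

Section Diagrams.
Variable r : nat.
Implicit Types p q s : setpart r.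

Definition unb : 'I_2 := ord0.
Definition bar : 'I_2 := ord_max.
Definition row0 : 'I_3 := ord0.
Definition row1 : 'I_3 := @Ordinal 3 1 isT.
Definition row2 : 'I_3 := ord_max.

Definition same p (u v : 'I_2 * 'I_r) : bool :=
  pblock p u == pblock p v.

(* Embeds the two rows, in order, into the two of three rows other than h. *)
Definition place (h : 'I_3) (u : 'I_2 * 'I_r) : 'I_3 * 'I_r := (lift h u.1, u.2).

(* p sits on rows 0 and 1, q on rows 1 and 2. *)
Definition glue p q : rel ('I_3 * 'I_r) := fun u v =>
  [exists a, exists b, [&& same p a b, u == place row2 a & v == place row2 b]]
  || [exists a, exists b, [&& same q a b, u == place row0 a & v == place row0 b]].

Lemma same_sym p u v : same p u v = same p v u.
Proof. exact: eq_sym. Qed.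

Lemma glue_sym p q : symmetric (glue p q).
Proof.
move=> u v; rewrite /glue; congr orb; apply/existsP/existsP => -[a /existsP [b]].
all: case/and3P=> sab ua vb; exists b; apply/existsP; exists a.
all: by rewrite same_sym sab ua vb.
Qed.


Lemma connect_glue_equiv p q : equivalence_rel (connect (glue p q)).
Proof.
apply/equivalence_relP; split; first exact: connect0.
move=> u v uv w; exact: (same_connect (sym_connect_sym (@glue_sym p q)) uv).
Qed.

Definition middle : {set 'I_3 * 'I_r} := [set u | u.1 == row1].

Definition components p q : {set {set 'I_3 * 'I_r}} :=
  equivalence_partition (connect (glue p q)) [set: 'I_3 * 'I_r].

Definition outer_rel p q : rel ('I_2 * 'I_r) :=
  fun a b => connect (glue p q) (place row1 a) (place row1 b).

Fact stack_proof p q :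
  partition (equivalence_partition (outer_rel p q) [set: 'I_2 * 'I_r])
            [set: 'I_2 * 'I_r].
Proof.
apply: equivalence_partitionP => u v w _ _ _; exact: connect_glue_equiv.
Qed.

End Diagrams.

HB.lock Definition stack r (p q : setpart r) : setpart r :=
  SetPart (stack_proof p q).

HB.lock Definition nmid r (p q : setpart r) : nat :=
  #|[set C in components p q | C \subset middle r]|.

Section BlockOfClass.
Variables (T : finType) (R : rel T) (eqR : equivalence_rel R).
Lemma mem_pblock_class (u v : T) :
  (v \in pblock (equivalence_partition R [set: T]) u) = R u v.
Proof.
by apply: pblock_equivalence_partition; rewrite ?inE // => a b c _ _ _.
Qed.
Lemma eq_pblock_class (u v : T) : (pblock (equivalence_partition R [set: T]) u ==
   pblock (equivalence_partition R [set: T]) v) = R u v.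
Proof.
have PP : partition (equivalence_partition R [set: T]) setT.
  by apply: equivalence_partitionP => a b c _ _ _; exact: eqR.
have [/eqP cP tP _] := and3P PP.
by rewrite eq_pblock ?cP ?inE // mem_pblock_class.
Qed.
End BlockOfClass.

Section DiagramTheory.
Variable r : nat.
Implicit Types p q s : setpart r.
Local Notation middle := (middle r).

Lemma same_stack p q a b : same (stack p q) a b = outer_rel p q a b.
Proof.
rewrite unlock; apply: eq_pblock_class => u v w; exact: connect_glue_equiv.
Qed.

Lemma setpart_inj p q : same p =2 same q -> p = q.
Proof.
move=> E; apply: val_inj => /=.
have H (s : setpart r) : s = [set pblock s u | u : 'I_2 * 'I_r] :> {set _}.
  have [/eqP cP tP n0] := and3P (setpartP s).
  apply/setP => B; apply/idP/imsetP => [Bs|[u _ ->]].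
    have [B0|[u uB]] := set_0Vmem B; first by rewrite -B0 Bs in n0.
    by exists u => //; rewrite (def_pblock tP Bs uB).
  by apply: pblock_mem; rewrite cP inE.
rewrite (H p) (H q); apply: eq_imset => u; apply/setP => v.
have K (s : setpart r) : (v \in pblock s u) = same s u v.
  have [/eqP cP tP n0] := and3P (setpartP s).
  by rewrite /same eq_pblock ?cP ?inE.
by rewrite !K E.
Qed.

Lemma same_equiv p : equivalence_rel (same p).
Proof. by move=> u v w; split; rewrite /same // => /eqP ->. Qed.

(* stack is determined by the 2-colourings constant on blocks: summing over the
   colours of the middle row counts each extension 2 ^ nmid times. *)
Definition col2 (f g : 'I_r -> bool) (u : 'I_2 * 'I_r) : bool :=
  if u.1 == unb then f u.2 else g u.2.
Definition col3 (f g h : 'I_r -> bool) (u : 'I_3 * 'I_r) : bool :=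
  if u.1 == row0 then f u.2 else if u.1 == row1 then g u.2 else h u.2.
Definition okb p (f g : 'I_r -> bool) : bool :=
  [forall u, forall v, same p u v ==> (col2 f g u == col2 f g v)].

Lemma okbP p f g :
  reflect (forall u v, same p u v -> col2 f g u = col2 f g v) (okb p f g).
Proof.
apply: (iffP forallP) => [H u v uv|H u].
  by have /forallP/(_ v)/implyP/(_ uv)/eqP := H u.
by apply/forallP => v; apply/implyP => uv; rewrite (H _ _ uv).
Qed.

Lemma col3_place2 f g h a : col3 f g h (place row2 a) = col2 f g a.
Proof. by case: a => [[[|[|//]] i] j]. Qed.
Lemma col3_place0 f g h a : col3 f g h (place row0 a) = col2 g h a.
Proof. by case: a => [[[|[|//]] i] j]. Qed.
Lemma col3_place1 f g h a : col3 f g h (place row1 a) = col2 f h a.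
Proof. by case: a => [[[|[|//]] i] j]. Qed.

Lemma ok3P p q f g h :
  reflect (forall u v, connect (glue p q) u v -> col3 f g h u = col3 f g h v)
    (okb p f g && okb q g h).
Proof.
apply: (iffP andP) => [[/okbP Hp /okbP Hq] u v /connectP [l]|H].
  elim: l u => [|w l IH] u /=; first by move=> _ ->.
  case/andP=> /orP uw wl vl; rewrite -(IH w wl vl) {IH wl vl}.
  case: uw => /existsP [a /existsP [b /and3P [ab /eqP -> /eqP ->]]].
    by rewrite !col3_place2 (Hp _ _ ab).
  by rewrite !col3_place0 (Hq _ _ ab).
split; apply/okbP => a b ab.
  rewrite -!(col3_place2 f g h); apply: H; apply: connect1; apply/orP; left.
  by apply/existsP; exists a; apply/existsP; exists b; rewrite ab !eqxx.
rewrite -!(col3_place0 f g h); apply: H; apply: connect1; apply/orP; right.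
by apply/existsP; exists a; apply/existsP; exists b; rewrite ab !eqxx.
Qed.

Lemma okb_stackP p q f h :
  reflect (forall a b, outer_rel p q a b -> col2 f h a = col2 f h b)
    (okb (stack p q) f h).
Proof.
by apply: (iffP (okbP _ _ _)) => H a b; [rewrite -same_stack|rewrite same_stack];
  exact: H.
Qed.

Lemma outer_place (u : 'I_3 * 'I_r) : u \notin middle -> {a | u = place row1 a}.
Proof.
case: u => i j; rewrite inE /= => ni.
case: (unliftP row1 i) => [i' ->|E]; first by exists (i', j).
by rewrite E eqxx in ni.
Qed.

Lemma count_ok p q (f h : {ffun 'I_r -> bool}) :
  (\sum_(g : {ffun 'I_r -> bool}) (okb p f g && okb q g h : nat) =
   okb (stack p q) f h * 2 ^ nmid p q)%N.
Proof.
have [ok|nok] := boolP (okb (stack p q) f h); last first.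
  rewrite mul0n big1 // => g _; case: ok3P => // H; case/negP: nok.
  apply/okb_stackP => a b ab; rewrite -!(col3_place1 f g h); exact: H.
rewrite mul1n.
set Free := [set C in components p q | C \subset middle].
pose pb := pblock (components p q).
pose bd C := if [pick v in C :\: middle] is Some v
  then col3 f [ffun=> false] h v else false.
pose Phi (phi : {ffun {set 'I_3 * 'I_r} -> bool}) C :=
  if C \in Free then phi C else bd C.
pose G phi : {ffun 'I_r -> bool} := [ffun i => Phi phi (pb (row1, i))].
have eqE := @connect_glue_equiv r p q.
have pbE u v : (pb u == pb v) = connect (glue p q) u v by exact: eq_pblock_class.
have mpb u v : (v \in pb u) = connect (glue p q) u v by exact: mem_pblock_class.
have GE phi u : col3 f (G phi) h u = Phi phi (pb u).
  have [um|um] := boolP (u \in middle).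
    case: u um => i j; rewrite inE /= => /eqP ->; rewrite /col3 /=.
    by rewrite /G ffunE.
  rewrite /Phi.
  have uu : u \in pb u by rewrite mpb connect0.
  rewrite ifN; last first.
    by apply: contra um; rewrite inE => /andP [_ /subsetP]; apply.
  rewrite /bd; case: pickP => [v|/(_ u)]; last by rewrite !inE in um *; rewrite um uu.
  case/setDP; rewrite mpb => uv vm.
  have [a Ea] := outer_place um; have [b Eb] := outer_place vm.
  have /okb_stackP/(_ a b) := ok; rewrite /outer_rel -Ea -Eb => /(_ uv).
  by rewrite Ea Eb !col3_place1.
have -> : (\sum_(g : {ffun 'I_r -> bool}) (okb p f g && okb q g h : nat))%N =
   #|[set g : {ffun 'I_r -> bool} | okb p f g && okb q g h]|.
  by rewrite -sum1dep_card [RHS]big_mkcond /=; apply: eq_bigr => g _; case: ifP.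
have -> : [set g : {ffun 'I_r -> bool} | okb p f g && okb q g h] =
   G @: pffun_on false (mem Free) predT.
  apply/setP => g; rewrite inE; apply/ok3P/imsetP => [H|[phi _ ->] u v uv].
    pose phi : {ffun {set 'I_3 * 'I_r} -> bool} := [ffun C => if C \in Free then
        (if [pick v in C] is Some v then g v.2 else false) else false].
    exists phi.
      apply/pffun_onP; split => //.
      by apply/supportP => C; rewrite /phi ffunE => /negbTE ->.
    apply/ffunP => i; have -> : g i = col3 f g h (row1, i) by [].
    have -> : G phi i = col3 f (G phi) h (row1, i) by [].
    rewrite GE /Phi; case: ifP => Fr.
      rewrite /phi ffunE Fr; case: pickP => [v|/(_ (row1, i))]; last first.
        by rewrite /= mpb connect0.
      rewrite mpb => iv; rewrite (H _ _ iv).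
      have : v \in middle.
        by move: Fr; rewrite inE => /andP [_ /subsetP]; apply; rewrite mpb.
      by case: v {iv} => a b; rewrite inE /= => /eqP ->.
    rewrite /bd; case: pickP => [v|N].
      rewrite !inE mpb => /andP [vm iv]; rewrite (H _ _ iv).
      rewrite /col3; case: ifP => // _; by rewrite (negbTE vm).
    case/negP: Fr; rewrite inE; apply/andP; split.
      apply: pblock_mem.
      have : partition (components p q) setT.
        by apply: equivalence_partitionP => a b c _ _ _; exact: eqE.
      by case/and3P => /eqP -> _ _; rewrite inE.
    apply/subsetP => v vp; apply: contraFT (N v) => vm; by rewrite inE vp vm.
  rewrite !GE; congr (Phi phi _); apply/eqP; by rewrite pbE.
rewrite card_in_imset; last first.
  move=> phi1 phi2 /pffun_onP [/supportP s1 _] /pffun_onP [/supportP s2 _] E.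
  apply/ffunP => C; have [Fr|Fr] := boolP (C \in Free); last first.
    by rewrite s1 // s2.
  have PP : partition (components p q) setT.
    by apply: equivalence_partitionP => a b c _ _ _; exact: eqE.
  have [_ tP n0] := and3P PP.
  have := Fr; rewrite inE => /andP [CP /subsetP Cm].
  have [C0|[[a i] uC]] := set_0Vmem C; first by rewrite -C0 CP in n0.
  have /= := Cm _ uC; rewrite inE /= => /eqP Ea; rewrite Ea in uC.
  have pC : pb (row1, i) = C by exact: def_pblock.
  by have /ffunP/(_ i) := E; rewrite /G !ffunE pC /Phi Fr.
by rewrite card_pffun_on [nmid]unlock card_bool.
Qed.

Lemma okb_inj p q : (forall f g : {ffun 'I_r -> bool}, okb p f g = okb q f g) -> p = q.
Proof.
move=> E; apply: setpart_inj => u v.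
have H (s : setpart r) : same s u v =
  [forall f : {ffun 'I_r -> bool}, forall g : {ffun 'I_r -> bool},
    okb s f g ==> (col2 f g u == col2 f g v)].
  apply/idP/forallP => [uv f|H].
    apply/forallP => g; apply/implyP => /okbP H; by rewrite (H _ _ uv).
  pose f := [ffun i => same s u (unb, i)]; pose g := [ffun i => same s u (bar, i)].
  have c2 w : col2 f g w = same s u w.
    case: w => i j; rewrite /col2 /=; case: ifPn => [/eqP -> | ni]; rewrite ffunE //.
    by have -> : i = bar by case: i ni => [[|[|//]] ?] // _; apply: val_inj.
  have /forallP/(_ g) := H f; rewrite !c2 => /implyP.
  have ok : okb s f g.
    apply/okbP => a b ab; rewrite !c2 /same; by rewrite (eqP ab).
  by move/(_ ok); rewrite (same_equiv s u u u).1 => /eqP <-.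
rewrite (H p) (H q); apply: eq_forallb => f; apply: eq_forallb => g.
by rewrite E.
Qed.

Lemma okb_cst p : okb p [ffun=> true] [ffun=> true].
Proof.
by apply/okbP => u v _; rewrite /col2; do 2![case: ifP => _]; rewrite !ffunE.
Qed.

Fact pow2_exp (b c : bool) m n : (b * 2 ^ m = c * 2 ^ n)%N -> b -> c -> m = n.
Proof.
by move=> E b1 c1; move/eqP: E; rewrite b1 c1 !mul1n eqn_exp2l // => /eqP.
Qed.

Fact pow2_bool (b c : bool) m n : (b * 2 ^ m = c * 2 ^ n)%N -> m = n -> b = c.
Proof.
move=> E mn; move/eqP: E; rewrite mn eqn_pmul2r ?expn_gt0 //.
by case: b; case: c.
Qed.

Lemma stackA p q s :
  stack (stack p q) s = stack p (stack q s) /\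
  (nmid p q + nmid (stack p q) s = nmid q s + nmid p (stack q s))%N.
Proof.
have keyl (f l : {ffun 'I_r -> bool}) :
  (\sum_(h : {ffun 'I_r -> bool}) \sum_(g : {ffun 'I_r -> bool})
     (okb p f g && okb q g h) * okb s h l =
   okb (stack (stack p q) s) f l * 2 ^ (nmid p q + nmid (stack p q) s))%N.
  rewrite expnD (mulnC (2 ^ nmid p q)%N) mulnA -count_ok big_distrl /=.
  apply: eq_bigr => h _.
  by rewrite -big_distrl /= count_ok mulnAC mulnb.
have keyr (f l : {ffun 'I_r -> bool}) :
  (\sum_(g : {ffun 'I_r -> bool}) \sum_(h : {ffun 'I_r -> bool})
     okb p f g * (okb q g h && okb s h l) =
   okb (stack p (stack q s)) f l * 2 ^ (nmid q s + nmid p (stack q s)))%N.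
  rewrite expnD (mulnC (2 ^ nmid q s)%N) mulnA -count_ok big_distrl /=.
  apply: eq_bigr => g _.
  by rewrite -big_distrr /= count_ok mulnA mulnb.
have key (f l : {ffun 'I_r -> bool}) :
  (okb (stack (stack p q) s) f l * 2 ^ (nmid p q + nmid (stack p q) s) =
   okb (stack p (stack q s)) f l * 2 ^ (nmid q s + nmid p (stack q s)))%N.
  apply: etrans (esym (keyl f l)) (etrans _ (keyr f l)).
  rewrite exchange_big; apply: eq_bigr => g _; apply: eq_bigr => h _.
  by rewrite !mulnb andbA.
have E2 := pow2_exp (key [ffun=> true] [ffun=> true]) (okb_cst _) (okb_cst _).
split; last exact: E2.
apply: okb_inj => f l; exact: pow2_bool (key f l) E2.
Qed.

End DiagramTheory.

Section PermDiagrams.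
Variable r : nat.
Implicit Types (p q : setpart r) (a b : 'S_r).

Definition perm_blocks a : {set {set 'I_2 * 'I_r}} :=
  [set [set (unb, a i); (bar, i)] | i : 'I_r].

Let key a (u : 'I_2 * 'I_r) : 'I_r := if u.1 == unb then u.2 else a u.2.

Fact perm_blocksE a : perm_blocks a = preim_partition (key a) [set: 'I_2 * 'I_r].
Proof.
have cls (u : 'I_2 * 'I_r) i : key a u = a i ->
    [set v in setT | key a u == key a v] = [set (unb, a i); (bar, i)].
  move=> E; apply/setP => -[c j]; rewrite !inE /= E /key /= !xpair_eqE.
  case: (unliftP unb c) => [c' | ] -> /=.
    have -> : lift unb c' = bar by apply: val_inj; case: c' => [[]].
    by rewrite (inj_eq perm_inj) eq_sym.
  by rewrite /= orbF eq_sym.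
apply/setP => B; apply/imsetP/imsetP => [[i _ ->]|[u _ ->]].
  by exists (bar, i); rewrite ?inE // (cls (bar, i) i).
exists (a^-1%g (key a u)) => //; by rewrite (cls u (a^-1%g (key a u))) ?permKV.
Qed.

Fact perm_blocks_proof a : partition (perm_blocks a) [set: 'I_2 * 'I_r].
Proof. by rewrite perm_blocksE; exact: preim_partitionP. Qed.

Definition perm_part a : setpart r :=
  SetPart (perm_blocks_proof a).

Fact same_perm a u v : same (perm_part a) u v = (key a u == key a v).
Proof.
rewrite /same /= perm_blocksE /preim_partition eq_pblock_class // => x y z.
by split; rewrite // => /eqP ->.
Qed.

Fact okb_perm a (f g : 'I_r -> bool) :
  okb (perm_part a) f g = [forall i, f (a i) == g i].
Proof.
have c2 u : (forall i, f (a i) == g i) -> col2 f g u = f (key a u).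
  by move=> H; rewrite /col2 /key; case: ifP => // _; rewrite (eqP (H _)).
apply/okbP/forallP => [H i|H u v].
  have := H (unb, a i) (bar, i); rewrite same_perm /key /= => /(_ (eqxx _)) E.
  by apply/eqP; exact: E.
by rewrite same_perm !c2 // => /eqP ->.
Qed.

Fact okb_perml a p (f h : {ffun 'I_r -> bool}) :
  (\sum_(g : {ffun 'I_r -> bool}) (okb (perm_part a) f g && okb p g h : nat))%N
  = okb p [ffun i => f (a i)] h.
Proof.
rewrite (bigD1 [ffun i => f (a i)]) //= big1 ?addn0 => [|g ng].
  rewrite okb_perm (_ : [forall _, _]) //; apply/forallP => i.
  by rewrite ffunE.
rewrite okb_perm; case: forallP => //= H; case/eqP: ng; apply/ffunP => i.
by rewrite ffunE (eqP (H i)).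
Qed.

Fact okb_permr a p (f h : {ffun 'I_r -> bool}) :
  (\sum_(g : {ffun 'I_r -> bool}) (okb p f g && okb (perm_part a) g h : nat))%N
  = okb p f [ffun i => h (a^-1%g i)].
Proof.
rewrite (bigD1 [ffun i => h (a^-1%g i)]) //= big1 ?addn0 => [|g ng].
  rewrite okb_perm; congr nat_of_bool.
  by rewrite (_ : [forall _, _]) ?andbT //; apply/forallP => i; rewrite ffunE permK.
rewrite okb_perm; case: forallP => //= H; last by rewrite andbF.
case/eqP: ng; apply/ffunP => i.
by rewrite ffunE -(eqP (H _)) permKV.
Qed.

Fact okb_ffun p (f g f' g' : 'I_r -> bool) :
  f =1 f' -> g =1 g' -> okb p f g = okb p f' g'.
Proof.
move=> E1 E2; rewrite /okb; apply: eq_forallb => u; apply: eq_forallb => v.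
by rewrite /col2 !E1 !E2.
Qed.

Fact nmid_perml a p : nmid (perm_part a) p = 0%N.
Proof.
have H := count_ok (perm_part a) p [ffun=> true] [ffun=> true].
rewrite okb_perml in H; apply: esym; apply: (@pow2_exp true true) => //.
rewrite expn0 -[RHS]/(true * 2 ^ _)%N.
have {1}<- : okb p [ffun i => [ffun=> true] (a i)] [ffun=> true] = true.
  rewrite -[RHS](okb_cst p); apply: okb_ffun => i; by rewrite !ffunE.
by rewrite muln1 H okb_cst.
Qed.

Fact nmid_permr a p : nmid p (perm_part a) = 0%N.
Proof.
have H := count_ok p (perm_part a) [ffun=> true] [ffun=> true].
rewrite okb_permr in H; apply: esym; apply: (@pow2_exp true true) => //.
rewrite expn0 -[RHS]/(true * 2 ^ _)%N.
have {1}<- : okb p [ffun=> true] [ffun i => [ffun=> true] (a^-1%g i)] = true.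
  rewrite -[RHS](okb_cst p); apply: okb_ffun => i; by rewrite !ffunE.
by rewrite muln1 H okb_cst.
Qed.

Fact okb_stack_perml a p (f h : {ffun 'I_r -> bool}) :
  okb (stack (perm_part a) p) f h = okb p [ffun i => f (a i)] h.
Proof.
have := count_ok (perm_part a) p f h; rewrite okb_perml nmid_perml => H.
by apply: (@pow2_bool _ _ 0 0); rewrite // -H expn0 muln1.
Qed.

Fact okb_stack_permr a p (f h : {ffun 'I_r -> bool}) :
  okb (stack p (perm_part a)) f h = okb p f [ffun i => h (a^-1%g i)].
Proof.
have := count_ok p (perm_part a) f h; rewrite okb_permr nmid_permr => H.
by apply: (@pow2_bool _ _ 0 0); rewrite // -H expn0 muln1.
Qed.

Lemma stack1p p : stack (perm_part 1) p = p.
Proof.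
apply: okb_inj => f h; rewrite okb_stack_perml; apply: okb_ffun => i //.
by rewrite ffunE perm1.
Qed.

Lemma stackp1 p : stack p (perm_part 1) = p.
Proof.
apply: okb_inj => f h; rewrite okb_stack_permr; apply: okb_ffun => i //.
by rewrite ffunE invg1 perm1.
Qed.

Lemma stack_perm a b : stack (perm_part a) (perm_part b) = perm_part (b * a)%g.
Proof.
apply: okb_inj => f h; rewrite okb_stack_perml !okb_perm; apply: eq_forallb => i.
by rewrite ffunE permM.
Qed.

End PermDiagrams.

Definition partalg (F : fieldType) (x : F) (r : nat) : Type :=
  {ffun setpart r -> F^o}.
HB.instance Definition _ (F : fieldType) (x : F) r :=
  Vector.copy (partalg x r) {ffun setpart r -> F^o}.

HB.lock Definition diag (F : fieldType) (x : F) r (p : setpart r) : partalg x r :=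
  [ffun q => (q == p)%:R].

HB.lock Definition partalg_mul (F : fieldType) (x : F) r (u v : partalg x r) :
    partalg x r :=
  \sum_p \sum_q (u p * v q : F) *: (x ^+ nmid p q *: diag x (stack p q)).

Section PartitionAlgebra.
Variables (F : fieldType) (x : F) (r : nat).
Implicit Types (u v w : partalg x r) (p q s : setpart r).
Local Notation partalg := (partalg x r).
Local Notation diag := (diag x).
Local Notation partalg_mul := (@partalg_mul F x r).

Lemma diagE p q : diag p q = (q == p)%:R.
Proof. by rewrite unlock ffunE. Qed.

Fact diag_expand u : u = \sum_p (u p : F) *: diag p.
Proof.
apply/ffunP => q; rewrite sum_ffunE (bigD1 q) //= big1 => [|p pq].
  by rewrite !ffunE diagE eqxx addr0 /GRing.scale /= mulr1.
by rewrite !ffunE diagE eq_sym (negbTE pq) scaler0.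
Qed.

Fact mul_linl v : linear (partalg_mul^~ v).
Proof.
move=> c u w; rewrite unlock scaler_sumr -big_split /=; apply: eq_bigr => p _.
rewrite scaler_sumr -big_split /=; apply: eq_bigr => q _.
rewrite !ffunE mulrDl scalerDl; congr (_ + _).
by rewrite [RHS]scalerA [RHS]/GRing.scale /= -mulrA.
Qed.

Fact mul_linr u : linear (partalg_mul u).
Proof.
move=> c v w; rewrite unlock scaler_sumr -big_split /=; apply: eq_bigr => p _.
rewrite scaler_sumr -big_split /=; apply: eq_bigr => q _.
rewrite !ffunE mulrDr scalerDl; congr (_ + _).
by rewrite [RHS]scalerA mulrCA.
Qed.

Fact lin_diag (V : lmodType F) (f g : partalg -> V) :
  linear f -> linear g -> (forall p, f (diag p) = g (diag p)) -> f =1 g.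
Proof.
move=> lf lg E u.
have H (h : partalg -> V) : linear h -> h u = \sum_p (u p : F) *: h (diag p).
  move=> lh.
  pose hL : {linear partalg -> V} := HB.pack h (GRing.isLinear.Build _ _ _ _ h lh).
  rewrite -[h]/(hL : _ -> _) {1}(diag_expand u) linear_sum.
  by apply: eq_bigr => p _; rewrite linearZ.
by rewrite (H f) // (H g) //; apply: eq_bigr => p _; rewrite E.
Qed.

Lemma mul_diag p q :
  partalg_mul (diag p) (diag q) = x ^+ nmid p q *: diag (stack p q).
Proof.
rewrite unlock (bigD1 p) //= [X in _ + X]big1 ?addr0 => [|s sp].
  rewrite (bigD1 q) //= [X in _ + X]big1 ?addr0 => [|s sq].
    by rewrite (diagE p) (diagE q) (eqxx p) (eqxx q) mulr1 scale1r.
  by rewrite (diagE q) (negbTE sq) mulr0 scale0r.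
by rewrite big1 // => t _; rewrite (diagE p) (negbTE sp) mul0r scale0r.
Qed.

Fact partalg_mulA : associative partalg_mul.
Proof.
have lZ (f : partalg -> partalg) c u : linear f -> f (c *: u) = c *: f u.
  move=> lf.
  pose fL : {linear _ -> _} := HB.pack f (GRing.isLinear.Build _ _ _ _ f lf).
  exact: (linearZ_LR fL).
have lZr c u v := lZ _ c v (mul_linr u).
have lZl c u v := lZ _ c u (mul_linl v).
move=> u v w; move: u; apply: lin_diag.
- exact: mul_linl.
- by move=> c u1 u2; rewrite !mul_linl.
move=> p; move: v; apply: lin_diag.
- by move=> c u1 u2; rewrite mul_linl mul_linr.
- by move=> c u1 u2; rewrite mul_linr mul_linl.
move=> q; move: w; apply: lin_diag.
- by move=> c u1 u2; rewrite (mul_linr (diag q)) (mul_linr (diag p)).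
- exact: (mul_linr (partalg_mul (diag p) (diag q))).
move=> s; rewrite (mul_diag q s) lZr (mul_diag p (stack q s)) (mul_diag p q) lZl.
rewrite (mul_diag (stack p q) s) [LHS]scalerA [RHS]scalerA -!exprD.
by have [-> ->] := stackA p q s.
Qed.

Fact partalg_mul1l : left_id (diag (perm_part 1)) partalg_mul.
Proof.
apply: lin_diag; [exact: mul_linr | by [] |].
by move=> p; rewrite mul_diag nmid_perml stack1p scale1r.
Qed.

Fact partalg_mul1r : right_id (diag (perm_part 1)) partalg_mul.
Proof.
apply: lin_diag; [exact: mul_linl | by [] |].
by move=> p; rewrite mul_diag nmid_permr stackp1 scale1r.
Qed.

Fact partalg_mulDl : left_distributive partalg_mul +%R.
Proof. by move=> u v w; have := mul_linl w 1 u v; rewrite !scale1r. Qed.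

Fact partalg_mulDr : right_distributive partalg_mul +%R.
Proof. by move=> u v w; have := mul_linr u 1 v w; rewrite !scale1r. Qed.

Fact partalg_1neq0 : diag (perm_part 1) != 0 :> partalg.
Proof.
by apply/eqP => /ffunP/(_ (@perm_part r 1))/eqP; rewrite diagE ffunE eqxx oner_eq0.
Qed.

HB.instance Definition _ := GRing.Zmodule_isNzRing.Build partalg
  partalg_mulA partalg_mul1l partalg_mul1r partalg_mulDl partalg_mulDr partalg_1neq0.

Fact partalg_scaleAl (c : F) (u v : partalg) : c *: (u * v) = (c *: u) * v.
Proof. by have := mul_linl v c u 0; rewrite !addr0 (_ : partalg_mul 0 v = 0) ?addr0 //; exact: mul0r. Qed.

Fact partalg_scaleAr (c : F) (u v : partalg) : c *: (u * v) = u * (c *: v).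
Proof. by have := mul_linr u c v 0; rewrite !addr0 (_ : partalg_mul u 0 = 0) ?addr0 //; exact: mulr0. Qed.

HB.instance Definition _ :=
  GRing.Lmodule_isLalgebra.Build F partalg partalg_scaleAl.
HB.instance Definition _ :=
  GRing.Lalgebra_isAlgebra.Build F partalg partalg_scaleAr.

End PartitionAlgebra.

Section OrbitBasis.
Variables (F : fieldType) (x : F) (r : nat).
Implicit Types (p q s : setpart r).

Definition coarser q p : bool :=
  [forall B in blocks p, exists C in blocks q, B \subset C].

Lemma coarserP q p :
  reflect (forall u v, same p u v -> same q u v) (coarser q p).
Proof.
have [/eqP cp tp np] := and3P (setpartP p).
have [/eqP cq tq nq] := and3P (setpartP q).
have mem_pblockE (s : setpart r) u v : (v \in pblock s u) = same s u v.
  have [/eqP cs ts _] := and3P (setpartP s).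
  by rewrite /same eq_pblock ?cs ?inE.
apply: (iffP forall_inP) => [H u v uv|H B Bp].
  have Pu : pblock p u \in blocks p by apply: pblock_mem; rewrite cp inE.
  have /exists_inP [C Cq /subsetP BC] := H _ Pu.
  have uC : u \in C by apply: BC; rewrite mem_pblock cp inE.
  rewrite -mem_pblockE (def_pblock tq Cq uC); apply: BC.
  by rewrite mem_pblockE.
have [B0|[u uB]] := set_0Vmem B; first by rewrite -B0 Bp in np.
apply/exists_inP; exists (pblock q u); first by apply: pblock_mem; rewrite cq inE.
apply/subsetP => v; rewrite -(def_pblock tp Bp uB) !mem_pblockE; exact: H.
Qed.

Lemma coarser_refl p : coarser p p.
Proof. exact/coarserP. Qed.

Lemma coarser_trans q p s : coarser p q -> coarser q s -> coarser p s.
Proof. by move=> /coarserP H /coarserP K; apply/coarserP => u v /K /H. Qed.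

Lemma coarser_anti p q : coarser p q -> coarser q p -> p = q.
Proof.
move=> /coarserP H /coarserP K; apply: setpart_inj => u v.
by apply/idP/idP => [/K|/H].
Qed.

Definition ncoarser p : nat := #|[set q | coarser q p]|.

Lemma ncoarser_lt p q : coarser q p -> q != p -> (ncoarser q < ncoarser p)%N.
Proof.
move=> qp nqp; apply/proper_card/properP; split.
  by apply/subsetP => s; rewrite !inE => /coarser_trans; exact.
exists p; rewrite !inE ?coarser_refl //.
by apply: contra nqp => pq; rewrite (coarser_anti qp pq).
Qed.

(* Solves diag p = \sum_(q coarser than p) orbit q for orbit p; the fuel
   ncoarser p decreases strictly along proper coarsenings. *)
Fixpoint orbit_rec (n : nat) p : partalg x r :=
  if n is n'.+1 then
    diag x p - \sum_(q | coarser q p && (q != p)) orbit_rec n' q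
  else 0.

Definition orbit p : partalg x r := orbit_rec (ncoarser p) p.

Fact orbit_rec_stable n m p :
  (ncoarser p <= n)%N -> (ncoarser p <= m)%N -> orbit_rec n p = orbit_rec m p.
Proof.
have pos q : (0 < ncoarser q)%N.
  by apply/card_gt0P; exists q; rewrite inE coarser_refl.
elim: n m p => [|n IH] m p; first by rewrite leqNgt pos.
case: m => [|m] /= pn pm; first by rewrite leqNgt pos in pm.
congr (_ - _); apply: eq_bigr => q /andP [qp nqp].
have lt := ncoarser_lt qp nqp.
by apply: IH; rewrite -ltnS; apply: leq_trans lt _.
Qed.

Lemma orbit_sum p : diag x p = \sum_(q | coarser q p) orbit q.
Proof.
rewrite (bigD1 p) ?coarser_refl //= {1}/orbit.
have : (0 < ncoarser p)%N by apply/card_gt0P; exists p; rewrite inE coarser_refl.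
case E: (ncoarser p) => [//|n] _ /=.
rewrite (eq_bigr orbit) ?subrK // => q /andP [qp nqp].
apply: orbit_rec_stable => //.
by rewrite -ltnS -E; exact: ncoarser_lt.
Qed.

Lemma orbit_unique (t : setpart r -> partalg x r) :
  (forall p, diag x p = \sum_(q | coarser q p) t q) -> t =1 orbit.
Proof.
move=> H p; have [n] := ubnP (ncoarser p); elim: n p => // n IH p lt.
have := H p; rewrite orbit_sum (bigD1 p) ?coarser_refl //=.
rewrite [in RHS](bigD1 p) ?coarser_refl //=.
rewrite (eq_bigr t) => [/addIr // | q /andP [qp nqp]].
by rewrite IH // (leq_trans (ncoarser_lt qp nqp)).
Qed.

End OrbitBasis.

(* The bound r on the entries follows from the sum; it only serves finiteness. *)
Record wcomp (r k : nat) := WComp {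
  wtuple :> k.-tuple 'I_r.+1;
  _ : sumn [seq nat_of_ord i | i <- wtuple] == r
}.
HB.instance Definition _ r k := [isSub for @wtuple r k].
HB.instance Definition _ r k := [Finite of wcomp r k by <:].

Section Corners.
Variables (r k : nat).
Implicit Types a b d : wcomp r k.

Definition wseq a : seq nat := [seq nat_of_ord i | i <- wtuple a].

Fact interval_proof a (i : 'I_r) : (reshape_index (wseq a) i < k)%N.
Proof.
have := @reshape_indexP (wseq a) i; rewrite size_map size_tuple; apply.
by rewrite /wseq (eqP (valP a)).
Qed.

Definition interval a (i : 'I_r) : 'I_k := Ordinal (interval_proof a i).

Definition young a : {set 'S_r} :=
  [set g : 'S_r | [forall i, interval a (g i) == interval a i]].

Lemma young_mul a g h : g \in young a -> ((h * g)%g \in young a) = (h \in young a).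
Proof.
rewrite inE => /forallP H; rewrite !inE; apply: eq_forallb => i.
by rewrite permM (eqP (H _)).
Qed.

Variables (F : fieldType) (x : F).

Definition symmetrizer a : partalg x r :=
  (#|young a|%:R)^-1 *: \sum_(g in young a) diag x (perm_part g).

Lemma symmetrizer_idem a : #|young a|%:R != 0 :> F ->
  symmetrizer a * symmetrizer a = symmetrizer a.
Proof.
move=> n0; rewrite /symmetrizer; set S := \sum_(g in _) _.
have diagM (g h : 'S_r) :
    diag x (perm_part g) * diag x (perm_part h) = diag x (perm_part (h * g)%g).
  have := mul_diag x (perm_part g) (perm_part h).
  by rewrite nmid_perml stack_perm expr0 scale1r.
have SS : S * S = #|young a|%:R *: S.
  rewrite {1}/S mulr_suml scaler_nat -sumr_const; apply: eq_bigr => g gy.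
  rewrite mulr_sumr (eq_bigr _ (fun h _ => diagM g h)).
  rewrite [RHS](reindex_inj (mulIg g)) /=; apply: eq_bigl => h.
  by rewrite young_mul.
rewrite -scalerAl -scalerAr SS; congr (_ *: _).
by rewrite scalerA mulVf // scale1r.
Qed.

Definition sandwich a b (f : partalg x r) : partalg x r := symmetrizer a * f * symmetrizer b.

Fact sandwich_linear a b : linear (sandwich a b).
Proof.
by move=> c u v; rewrite /sandwich mulrDr mulrDl -(scalerAr c) -(scalerAl c).
Qed.
HB.instance Definition _ a b := GRing.isLinear.Build F (partalg x r) (partalg x r) _
  (sandwich a b) (sandwich_linear a b).

Definition corner a b : {vspace partalg x r} := limg (linfun (sandwich a b)).

Fact cornerP a b (u : partalg x r) :
  reflect (exists f, u = symmetrizer a * f * symmetrizer b) (u \in corner a b).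
Proof.
apply: (iffP idP) => [/memv_imgP [f _ ->]|[f ->]].
  by exists f; rewrite lfunE.
by apply/memv_imgP; exists f; rewrite ?memvf // lfunE.
Qed.

Definition in_corners : {pred {ffun wcomp r k * wcomp r k -> partalg x r}} :=
  fun u => [forall ab, u ab \in corner ab.1 ab.2].

Fact in_corners_submod : submod_closed in_corners.
Proof.
split=> [|c u v /forallP uP /forallP vP]; apply/forallP => ab; rewrite !ffunE.
  exact: mem0v.
by rewrite memvD // memvZ.
Qed.
HB.instance Definition _ := GRing.isSubmodClosed.Build _ _ in_corners
  in_corners_submod.

(* u (a, b) is the component of u in s_a P_r(x) s_b. *)
Record ptilde := PTilde {
  pcomp :> {ffun wcomp r k * wcomp r k -> partalg x r};
  _ : in_corners pcomp
}.
HB.instance Definition _ := [isSub for pcomp].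
HB.instance Definition _ := [Choice of ptilde by <:].
HB.instance Definition _ := [SubChoice_isSubLmodule of ptilde by <:].

Fact ptilde_corner (u : ptilde) a b : u (a, b) \in corner a b.
Proof. by have /forallP/(_ (a, b)) := valP u. Qed.

Fact ptilde_mul_proof (u v : ptilde) :
  in_corners [ffun ab => \sum_d u (ab.1, d) * v (d, ab.2)].
Proof.
apply/forallP => -[a b] /=; rewrite ffunE; apply: memv_suml => d _ /=.
have /cornerP [f ->] := ptilde_corner u a d.
have /cornerP [g ->] := ptilde_corner v d b.
by apply/cornerP; exists (f * symmetrizer d * (symmetrizer d * g)); rewrite !mulrA.
Qed.

(* As s_d is idempotent, (s_a f s_d) (s_d g s_b) = s_a f s_d g s_b. *)
Definition ptilde_mul (u v : ptilde) : ptilde := PTilde (ptilde_mul_proof u v).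

Fact corner_elt_proof a b (f : partalg x r) :
  in_corners [ffun cd => if cd == (a, b) then symmetrizer a * f * symmetrizer b else 0].
Proof.
apply/forallP => -[c d]; rewrite ffunE; case: eqP => [[-> ->]|_] /=.
  by apply/cornerP; exists f.
exact: mem0v.
Qed.

Definition corner_elt a b (f : partalg x r) : ptilde :=
  PTilde (corner_elt_proof a b f).

(* s_a 1 s_a = s_a. *)
Definition ptilde_one : ptilde := \sum_a corner_elt a a 1.

End Corners.

(* The product m(M)! of the factorials of the multiplicities in M. *)
Definition mfact (K : choiceType) (M : {mset K}) : nat :=
  (\prod_(y <- undup M) (M y)`!)%N.

Definition row_size m k (i : 'I_m) (B : {mset 'I_m * 'I_k}) : nat :=
  count (fun l : 'I_m * 'I_k => l.1 == i) B.

Definition row_count m k (i : 'I_m) (P : {mset {mset 'I_m * 'I_k}}) : nat :=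
  (\sum_(B <- P) row_size i B)%N.

(* The letter (i, j) is j with i bars, so m = 2 gives multiset partitions on
   [k] and [k-bar], m = 3 those that also use [k-bar-bar]. *)
Record mspart (m r k : nat) := MSPart {
  mblocks :> {mset {mset 'I_m * 'I_k}};
  _ : (mset0 \notin mblocks) && [forall i, row_count i mblocks == r]
}.
HB.instance Definition _ m r k := [isSub for @mblocks m r k].
HB.instance Definition _ m r k := [Choice of mspart m r k by <:].

Module MSPartFinite.
Section MultisetPartitionFinite.
Variables (m r k : nat).
Local Notation T := ('I_m * 'I_k)%type.
Local Notation N := (m * r)%N.
Local Notation code := {ffun {ffun T -> 'I_N.+1} -> 'I_N.+1}.

Definition mset_of_ffun (U : finType) (K : choiceType) (f : U -> K)
    (g : {ffun U -> 'I_N.+1}) : {mset K} :=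
  seq_mset (flatten [seq nseq (g u) (f u) | u <- enum U]).

Fact mset_of_ffunE U K f g y :
  @mset_of_ffun U K f g y = (\sum_(u | f u == y) g u)%N.
Proof.
rewrite mset_seqE count_flatten -map_comp sumnE big_map big_enum /=.
rewrite [RHS]big_mkcond; apply: eq_bigr => u _ /=.
by rewrite count_nseq /=; case: eqP; rewrite ?mul1n.
Qed.

Definition block (g : {ffun T -> 'I_N.+1}) : {mset T} := mset_of_ffun id g.

Fact blockE g t : block g t = g t.
Proof. by rewrite mset_of_ffunE big_pred1_eq. Qed.

Fact block_inj : injective block.
Proof.
move=> g h E; apply/ffunP => t; apply: val_inj.
by rewrite /= -!blockE E.
Qed.

Definition encode (P : mspart m r k) : code := [ffun g => inord (mblocks P (block g))].
Definition decode (h : code) : option (mspart m r k) := insub (mset_of_ffun block h).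

Fact mspart_size (P : mspart m r k) : (\sum_(B <- P) size (B : {mset T}) = N)%N.
Proof.
have /andP [_ /forallP rc] := valP P.
transitivity (\sum_(i < m) row_count i P)%N; last first.
  by rewrite (eq_bigr (fun=> r)) ?sum_nat_const ?card_ord // => i _; apply/eqP.
rewrite /row_count exchange_big /=; apply: eq_bigr => B _.
rewrite -sum1_size (partition_big (fun l : T => l.1) predT) //=.
by apply: eq_bigr => i _; rewrite sum1_count.
Qed.

Fact mspart_encodeK : pcancel encode decode.
Proof.
move=> P; rewrite /decode -[RHS](valK P); congr insub; apply/msetP => B.
have sz := mspart_size P; have /andP [n0 _] := valP P.
have Psz : (size (mblocks P) <= N)%N.
  rewrite -sz -sum1_size big_seq [leqRHS]big_seq; apply: leq_sum => C CP.
  rewrite lt0n; apply: contraNneq n0 => /size0nil C0; move: CP.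
  suff -> : C = mset0 by [].
  by rewrite -(seq_mset_id C) C0; apply/msetP => y; rewrite mset_seqE mset0E.
have Pmult C : (mblocks P C < N.+1)%N.
  by rewrite ltnS -count_mem_mset (leq_trans (count_size _ _)).
rewrite mset_of_ffunE.
have [BP|BP] := boolP (B \in mblocks P); last first.
  rewrite big1 => [|g /eqP gB]; first by apply/esym/eqP; rewrite mset_eq0.
  by rewrite ffunE gB inordK ?Pmult //; apply/eqP; rewrite mset_eq0.
have Bmult t : (B t < N.+1)%N.
  rewrite ltnS -count_mem_mset (leq_trans (count_size _ _)) // -sz.
  by rewrite (big_rem B) //= leq_addr.
have gB : block [ffun t => inord (B t)] = B.
  by apply/msetP => t; rewrite blockE ffunE inordK.
rewrite (big_pred1 [ffun t => inord (B t)]); last first.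
  by move=> g; rewrite /= -{1}gB (inj_eq block_inj).
by rewrite ffunE gB inordK.
Qed.

End MultisetPartitionFinite.
End MSPartFinite.
HB.instance Definition _ m r k := PCanIsCountable (@MSPartFinite.mspart_encodeK m r k).
HB.instance Definition _ m r k : isFinite (mspart m r k) :=
  PCanIsFinite (@MSPartFinite.mspart_encodeK m r k).

Section MultisetPartitions.
Variables (r k : nat).

(* Restriction to the letters outside row h, followed by the order-preserving
   renumbering of the remaining rows: h = 1 also removes one bar from the
   double-barred letters, h = 0 removes one bar from all of them. *)
Definition drop_block m (h : 'I_m) (B : {mset 'I_m * 'I_k}) :
    {mset 'I_m.-1 * 'I_k} :=
  seq_mset (pmap (fun l => omap (fun i => (i, l.2)) (unlift h l.1)) B).

Definition drop_blocks m (h : 'I_m) (P : {mset {mset 'I_m * 'I_k}}) :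
    {mset {mset 'I_m.-1 * 'I_k}} :=
  seq_mset [seq B <- [seq drop_block h C | C <- P] | B != mset0].

Fact drop_row_proof m (h : 'I_m) (P : mspart m r k) :
  (mset0 \notin drop_blocks h P) && [forall i, row_count i (drop_blocks h P) == r].
Proof.
have /andP [n0 /forallP rc] := valP P.
rewrite (perm_mem (perm_eq_seq_mset _)) mem_filter eqxx /=; apply/forallP => i.
apply/eqP; rewrite -[RHS](eqP (rc (lift h i))) /row_count.
rewrite (perm_big _ (perm_eq_seq_mset _)) /=.
rewrite big_filter big_mkcond /= big_map; apply: eq_bigr => B _.
have -> : row_size (lift h i) B = row_size i (drop_block h B).
  rewrite /row_size (seq.permP (perm_eq_seq_mset _)) /=; elim: (enum_mset B) => //= l s ->.
  case: unliftP => [j ->|->] /=; first by rewrite (inj_eq lift_inj).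
  by rewrite eq_liftF.
by case: eqP => // ->; rewrite /row_size enum_mset0.
Qed.

Definition drop_row m (h : 'I_m) (P : mspart m r k) : mspart m.-1 r k :=
  MSPart (drop_row_proof h P).

Section Content.
Variables (i : 'I_2) (pt : mspart 2 r k).

Definition multiplicity (j : 'I_k) : nat := (\sum_(B <- pt) (B : {mset 'I_2 * 'I_k}) (i, j))%N.

Fact sum_multiplicity : (\sum_j multiplicity j = r)%N.
Proof.
have /andP [_ /forallP/(_ i)/eqP rc] := valP pt.
rewrite -[RHS]rc /multiplicity /row_count exchange_big /=; apply: eq_bigr => B _.
rewrite /row_size -sum1_count (partition_big (fun l : 'I_2 * 'I_k => l.2) predT) //=.
apply: eq_bigr => j _; rewrite -count_mem_mset -sum1_count; apply: eq_bigl => l.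
by case: l => a b; rewrite /= xpair_eqE.
Qed.

Definition content_tuple : k.-tuple 'I_r.+1 := [tuple inord (multiplicity j) | j < k].

Fact content_proof : sumn [seq nat_of_ord n | n <- content_tuple] == r.
Proof.
rewrite /= -map_comp sumnE big_map big_enum /= -[X in _ == X]sum_multiplicity.
apply/eqP; apply: eq_bigr => j _ /=; rewrite inordK // ltnS.
by rewrite -[leqRHS]sum_multiplicity (bigD1 j) //= leq_addr.
Qed.

Definition content : wcomp r k := WComp content_proof.
End Content.

Definition kappa_block (a b : wcomp r k) (B : {set 'I_2 * 'I_r}) :
    {mset 'I_2 * 'I_k} :=
  seq_mset [seq (v.1, interval (if v.1 == unb then a else b) v.2) | v <- enum B].

Definition kappa_blocks (a b : wcomp r k) (p : setpart r) :
    {mset {mset 'I_2 * 'I_k}} :=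
  seq_mset [seq kappa_block a b B | B <- enum (blocks p)].

Fact kappa_proof a b p :
  (mset0 \notin kappa_blocks a b p)
  && [forall i, row_count i (kappa_blocks a b p) == r].
Proof.
have [/eqP cp tp np] := and3P (setpartP p); apply/andP; split.
  rewrite (perm_mem (perm_eq_seq_mset _)); apply/mapP => -[B].
  rewrite mem_enum => Bp /esym B0; have [E|[v vB]] := set_0Vmem B.
    by rewrite -E Bp in np.
  have : (v.1, interval (if v.1 == unb then a else b) v.2) \in kappa_block a b B.
    rewrite (perm_mem (perm_eq_seq_mset _)); apply/mapP; exists v => //.
    by rewrite mem_enum.
  by rewrite B0 in_mset0.
apply/forallP => i; rewrite /row_count (perm_big _ (perm_eq_seq_mset _)) /=.
rewrite big_map big_enum /=.
have rowE B : row_size i (kappa_block a b B) =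
    (\sum_(v in B) (v.1 == i))%N.
  rewrite /row_size (seq.permP (perm_eq_seq_mset _)) count_map -sum1_count big_enum_cond /=.
  by rewrite big_mkcondr /=; apply: eq_bigr => v _; case: eqP.
rewrite (eq_bigr _ (fun B _ => rowE B)) -(big_trivIset _ tp) cp /=.
rewrite (eq_bigl xpredT) => [|v]; last by rewrite inE.
rewrite -(pair_bigA _ (fun (j : 'I_2) (_ : 'I_r) => (j == i) : nat)) /=.
rewrite (bigD1 i) //= [X in (_ + X)%N]big1 ?addn0 => [|j /negbTE ->].
  by rewrite eqxx sum_nat_const card_ord muln1.
by rewrite big1.
Qed.

Definition kappa (a b : wcomp r k) (p : setpart r) : mspart 2 r k :=
  MSPart (kappa_proof a b p).

Variables (F : fieldType) (x : F).

Definition omega (pt : mspart 2 r k) : F :=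
  (mfact pt)%:R / #|young (content unb pt)|%:R *
  \prod_(B <- mblocks pt)
    (mfact (seq_mset [seq l <- (B : {mset 'I_2 * 'I_k}) | l.1 == bar]))%:R.

Definition mpalg : Type := {ffun mspart 2 r k -> F^o}.
HB.instance Definition _ := Vector.copy mpalg {ffun mspart 2 r k -> F^o}.

Definition mpbasis (pt : mspart 2 r k) : mpalg := [ffun pt' => (pt' == pt)%:R].

(* The set Gamma^pt_nu. *)
Definition overlays (pt nu : mspart 2 r k) : {set mspart 3 r k} :=
  [set g | (drop_row row2 g == pt) && (drop_row row0 g == nu)].

(* The blocks C of g whose restriction to rows 0 and 2 is S. *)
Definition fibre (g : mspart 3 r k) (S : {mset 'I_2 * 'I_k}) :
    {mset {mset 'I_3 * 'I_k}} :=
  seq_mset [seq C <- mblocks g | drop_block row1 C == S].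

Definition acoef (g : mspart 3 r k) : F :=
  \prod_(S <- undup (mblocks (drop_row row1 g)))
    ((size (fibre g S))`!%:R / (mfact (fibre g S))%:R).

(* The blocks beta_g containing only barred letters. *)
Definition middle_blocks (g : mspart 3 r k) : {mset {mset 'I_3 * 'I_k}} :=
  seq_mset [seq C <- mblocks g |
     all (fun l : 'I_3 * 'I_k => l.1 == row1) (C : {mset 'I_3 * 'I_k})].

Definition falling (y : F) (n : nat) : F := \prod_(i < n) (y - i%:R).

Definition bcoef (g : mspart 3 r k) : F :=
  falling (x - (size (mblocks (drop_row row1 g)))%:R) (size (middle_blocks g)) /
  (mfact (middle_blocks g))%:R.

Definition mp_mul (u v : mpalg) : mpalg :=
  \sum_pt \sum_nu (u pt * v nu : F) *:
    \sum_(g in overlays pt nu) (acoef g * bcoef g) *: mpbasis (drop_row row1 g).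

(* O_pt computed from a representative p; meaningful when kappa sends p to pt. *)
Definition orbit_like (pt : mspart 2 r k) (p : setpart r) : ptilde r k x :=
  corner_elt (content unb pt) (content bar pt) (orbit x p).

End MultisetPartitions.

Section Isomorphism.
Variables (r k : nat) (F : fieldType) (x : F).

Definition maps_orbit_basis (phi : ptilde r k x -> mpalg r k F) : Prop :=
  forall (pt : mspart 2 r k) (p : setpart r),
    kappa (content unb pt) (content bar pt) p = pt ->
    phi (orbit_like x pt p) = omega F pt *: mpbasis F pt.

End Isomorphism.

Record alg_iso (F : fieldType) (A B : lmodType F) (mulA : A -> A -> A) (oneA : A)
    (mulB : B -> B -> B) (phi : {linear A -> B}) : Prop := AlgIso {
  alg_iso_bij : bijective phi;
  alg_iso_mul : {morph phi : u v / mulA u v >-> mulB u v};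
  alg_iso_one : left_id (phi oneA) mulB /\ right_id (phi oneA) mulB
}.

(* C(x) and its indeterminate, with C = R[i]. *)
Definition ratfun (R : realType) : fieldType := {fraction {poly R[i]}}.
Definition indet (R : realType) : ratfun R := tofrac 'X.

(* Main.v *)
(* A palette D of at least 3r colours lets the partition algebra act on pairs of
   words of length r in D: an element u has the entry rho f h u, the sum of its
   coefficients at the diagrams whose blocks are coloured constantly by (f, h).
   Then rho of an orbit basis element is an indicator function, and products are
   matrix products in which the middle word g carries a weight correcting the
   number of colours from #|D| to x (rhoM); this replaces specialising x to
   large integers.  Grouping the letters of a tuple of words by colour gives a
   multiset partition, and both algebras are compared on such word types: rho of
   s_a T_p s_b at (f, h) is a constant times the indicator of the type of (f, h)
   being kappa(p), and the weighted number of middle words g for which (f, g, h)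
   has type G is, up to normalisation, a_G b_G(x).  Both counts reduce to
   counting injections that respect prescribed values. *)
Require Import Defs.
From HB Require Import structures.
From mathcomp Require Import all_boot all_order all_fingroup all_algebra.
From mathcomp Require Import finmap multiset.
From mathcomp Require Import ring.
From mathcomp Require Import reals complex.
Import GRing.Theory.
Local Open Scope ring_scope.
Set Implicit Arguments.
Unset Strict Implicit.
Unset Printing Implicit Defensive.
(* matrix.v declares lemmas named row0 and row1. *)
Import Defs.
Local Open Scope mset_scope.

(** * Counting injections *)

(** Diagrams act on words in n colours with parameter n, because a component in the middle has n
    colourings. The weight [wt] turns each such n into x: a middle word with k colours outside the
    set U of outer colours is weighted by the quotient of (x-|U|)_k by (n-|U|)_k, and this numerator
    is the one in b_G. The bound 3r allows 2r colours for the two outer words and r for the middle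
    one, so that no denominator vanishes; 2r colours already realise each set partition as the
    kernel of a pair of words. The map [phi] is not prescribed on a basis. It reads the entry of u
    at one pair of words of type pt, and for u in a corner this entry depends on the type alone.
    Injectivity thus comes from faithfulness of [rho], while the values at the orbit-like elements
    give a right inverse; that these elements span is a consequence. The scalar in [phi] cancels the
    stabiliser order of the unbarred word and the order of the barred Young subgroup, which leaves
    exactly omega. *)

Section FfunOnOrd.
Variable X : finType.

Definition fcons m (c : X) (e : {ffun 'I_m -> X}) : {ffun 'I_m.+1 -> X} :=
  [ffun i => oapp e c (unlift ord0 i)].

Lemma fcons0 m c (e : {ffun 'I_m -> X}) : fcons c e ord0 = c.
Proof. by rewrite ffunE unlift_none. Qed.

Lemma fconsS m c (e : {ffun 'I_m -> X}) i : fcons c e (lift ord0 i) = e i.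
Proof. by rewrite ffunE liftK. Qed.

Lemma big_fcons (R : Type) (idx : R) (op : Monoid.com_law idx) m
    (P : {ffun 'I_m.+1 -> X} -> R) :
  \big[op/idx]_e P e = \big[op/idx]_e \big[op/idx]_c P (fcons c e).
Proof.
rewrite pair_bigA /=.
rewrite (reindex (fun p : {ffun 'I_m -> X} * X => fcons p.2 p.1)) //=.
exists (fun e : {ffun 'I_m.+1 -> X} => ([ffun i => e (lift ord0 i)], e ord0)).
  move=> [e c] _ /=; congr (_, _); last by rewrite fcons0.
  by apply/ffunP => i; rewrite ffunE fconsS.
move=> e _; apply/ffunP => i; rewrite ffunE.
by case: unliftP => [j|] -> //=; rewrite ffunE.
Qed.

Lemma big_ffun_enum_rank (R : Type) (idx : R) (op : Monoid.com_law idx) (A : finType)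
    (P : {ffun A -> X} -> R) :
  \big[op/idx]_e P e =
  \big[op/idx]_(e : {ffun 'I_#|A| -> X}) P [ffun a => e (enum_rank a)].
Proof.
rewrite (reindex (fun e : {ffun 'I_#|A| -> X} => [ffun a => e (enum_rank a)])) //=.
exists (fun e : {ffun A -> X} => [ffun i => e (enum_val i)]).
  by move=> e _; apply/ffunP => i; rewrite !ffunE enum_valK.
by move=> e _; apply/ffunP => i; rewrite !ffunE enum_rankK.
Qed.

Lemma fcons_inj m c (e : {ffun 'I_m -> X}) :
  injectiveb (fcons c e) = (c \notin codom e) && injectiveb e.
Proof.
apply/injectiveP/andP => [I|[/codomP ce /injectiveP I] i j].
  split; last by apply/injectiveP => i j E; apply: (@lift_inj _ ord0); apply: I; rewrite !fconsS.
  apply/codomP => -[i E]; have := I ord0 (lift ord0 i).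
  by rewrite fcons0 fconsS => /(_ E) /eqP; rewrite eq_liftF.
case: (unliftP ord0 i) => [i'|] ->; case: (unliftP ord0 j) => [j'|] ->;
  rewrite ?fcons0 ?fconsS // => E; first by rewrite (I _ _ E).
- by case: ce; exists i'.
- by case: ce; exists j'.
Qed.

Lemma codom_fcons m c (e : {ffun 'I_m -> X}) y :
  (y \in codom (fcons c e)) = (y == c) || (y \in codom e).
Proof.
apply/codomP/orP => [[i ->]|[/eqP ->|/codomP [i ->]]].
- case: (unliftP ord0 i) => [i'|] ->; rewrite ?fcons0 ?fconsS ?eqxx; last by left.
  by right; exact: codom_f.
- by exists ord0; rewrite fcons0.
- by exists (lift ord0 i); rewrite fconsS.
Qed.

End FfunOnOrd.

Section CountInjections.
Variables (X : finType) (Y : eqType) (g : X -> Y).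

(** Injective lifts of [d] along [g]. They serve both for permutations that carry one word to
    another and for assignments of colours to blocks. *)
Definition inj_over (A : finType) (d : A -> Y) (e : {ffun A -> X}) :=
  injectiveb e && [forall a, g (e a) == d a].

Lemma inj_overP (A : finType) (d : A -> Y) (e : {ffun A -> X}) :
  reflect (injective e /\ forall a, g (e a) = d a) (inj_over d e).
Proof.
apply: (iffP andP) => -[/injectiveP I H]; split=> //.
  by move=> a; apply/eqP; have /forallP := H; exact.
by apply/forallP => a; rewrite H.
Qed.

(** A lift is an independent choice, for each y, of an injection from the fibre of [d] into the
    fibre of [g], whence the falling factorials. [Y] may be infinite, so the product runs over a
    list that contains all values of [d]. *)
Lemma card_inj_over_ord m (d : 'I_m -> Y) (s : seq Y) :
  uniq s -> (forall a, d a \in s) ->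
  (\sum_(e : {ffun 'I_m -> X}) inj_over d e =
   \prod_(y <- s) #|[pred c | g c == y]| ^_ #|[pred a | d a == y]|)%N.
Proof.
elim: m d => [|m IH] d us ds.
  rewrite [RHS]big1_seq => [|y _]; last first.
    by rewrite (@eq_card0 _ [pred a | d a == y]) ?ffactn0 // => -[].
  rewrite (eq_bigr (fun=> 1%N)) => [|e _]; first by rewrite sum1_card card_ffun card_ord.
  by rewrite (introT (inj_overP _ _)) //; split=> -[].
pose d' i := d (lift ord0 i).
have card_d y : #|[pred a | d a == y]| = (#|[pred a | d' a == y]| + (d ord0 == y))%N.
  rewrite -!sum1_card big_mkcond [in RHS]big_mkcond big_ord_recl addnC /=.
  by congr addn; rewrite inE; case: ifP => ->.
have step (e : {ffun 'I_m -> X}) :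
    (\sum_c inj_over d (fcons c e) = inj_over d' e *
      (#|[pred c | g c == d ord0]| - #|[pred a | d' a == d ord0]|))%N.
  have E c : inj_over d (fcons c e) =
      [&& inj_over d' e, g c == d ord0 & c \notin codom e].
    rewrite /inj_over fcons_inj.
    have -> : [forall a, g (fcons c e a) == d a] =
        (g c == d ord0) && [forall a, g (e a) == d' a].
      apply/forallP/andP => [H|[H /forallP K] i].
        split; first by have := H ord0; rewrite fcons0.
        by apply/forallP => i; have := H (lift ord0 i); rewrite fconsS.
      by case: (unliftP ord0 i) => [j|] ->; rewrite ?fconsS ?fcons0 //; exact: K.
    by case: (c \notin codom e); case: (injectiveb e); case: (g c == d ord0);
      case: [forall a, g (e a) == d' a].
  rewrite (eq_bigr _ (fun c _ => congr1 nat_of_bool (E c))).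
  case: inj_overP => [[I H]|_]; last by rewrite big1.
  rewrite mul1n; transitivity #|[pred c | g c == d ord0 & c \notin codom e]|.
    by rewrite -sum1_card [RHS]big_mkcond; apply: eq_bigr => c _; rewrite inE /=; case: andP.
  (* The points of this fibre already used by [e] inject into it, so the truncated subtraction is
     exact. *)
  apply/eqP; rewrite -(eqn_add2l #|[pred a | d' a == d ord0]|) subnKC.
    rewrite -(cardID [pred c | c \in codom e] [pred c | g c == d ord0]).
    apply/eqP; congr addn; last by apply: eq_card => c; rewrite !inE andbC.
    rewrite -(card_imset _ I); apply: eq_card => c; rewrite !inE.
    apply/imsetP/andP => [[a]|[/eqP cd /codomP [a E']]].
      by rewrite inE => /eqP da ->; rewrite codom_f H da.
    by exists a => //; rewrite inE -H -E' cd.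
  rewrite -(card_imset _ I); apply/subset_leq_card/subsetP => c /imsetP [a].
  by rewrite inE => da ->; rewrite inE H.
rewrite big_fcons (eq_bigr _ (fun e _ => step e)) -big_distrl /= IH //; last by move=> a; exact: ds.
rewrite (bigD1_seq (d ord0)) //= [in RHS](bigD1_seq (d ord0)) //=.
rewrite card_d eqxx addn1 ffactnSr mulnAC; congr (_ * _)%N.
by apply: eq_bigr => y yd; rewrite card_d eq_sym (negbTE yd) addn0.
Qed.

Lemma card_inj_over (A : finType) (d : A -> Y) (s : seq Y) :
  uniq s -> (forall a, d a \in s) ->
  (\sum_(e : {ffun A -> X}) inj_over d e =
   \prod_(y <- s) #|[pred c | g c == y]| ^_ #|[pred a | d a == y]|)%N.
Proof.
move=> us ds; rewrite big_ffun_enum_rank.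
have cE y : #|[pred a | d a == y]| = #|[pred i : 'I_#|A| | d (enum_val i) == y]|.
  rewrite -[RHS](card_imset _ enum_val_inj).
  apply: eq_card => a; rewrite inE; apply/idP/imsetP => [da|[i ia ->] //].
  by exists (enum_rank a); rewrite ?inE enum_rankK.
under [RHS]eq_bigr do rewrite cE.
rewrite -(card_inj_over_ord us) => [|i]; last exact: ds.
apply: eq_bigr => e _; congr nat_of_bool; apply/inj_overP/inj_overP => -[I H].
  split=> [i j E|i]; last by rewrite -H ffunE enum_valK.
  by apply: enum_val_inj; apply: I; rewrite !ffunE !enum_valK.
split=> [i j|a]; last by rewrite ffunE H enum_rankK.
by rewrite !ffunE => /I /enum_rank_inj.
Qed.

End CountInjections.

(** * Weighted colourings *)

Section WeightedColourings.
Variables (F : fieldType) (x : F) (D : finType).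
Hypothesis char0 : forall n, n.+1%:R != 0 :> F.

Lemma fallingS (y : F) n : falling y n.+1 = falling y n * (y - n%:R).
Proof. by rewrite /falling big_ord_recr. Qed.

Lemma falling_neq0 n m : (m <= n)%N -> falling (n%:R : F) m != 0.
Proof.
move=> mn; apply/prodf_neq0 => i _.
rewrite -natrB ?(ltnW (leq_trans (ltn_ord i) mn)) //.
have : (0 < n - i)%N by rewrite subn_gt0 (leq_trans (ltn_ord i) mn).
by case: (n - i)%N.
Qed.

(* The conditional weight of a colouring that uses k colours outside U, given the
   colours in U, were the palette D to have x colours. *)
Definition wt (U : {set D}) (k : nat) : F :=
  falling (x - #|U|%:R) k / falling (#|D|%:R - #|U|%:R) k.

Definition new_colours (U : {set D}) (A : finType) (e : A -> D) : nat :=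
  #|[set c in codom e | c \notin U]|.

Lemma new_colours_leq (U : {set D}) (A : finType) (e : A -> D) : (new_colours U e <= #|A|)%N.
Proof.
apply: leq_trans (subset_leq_card _) (leq_image_card e predT).
by apply/subsetP => c; rewrite inE => /andP [].
Qed.

(** After k new colours, the next letter either repeats one of |U|+k colours, with the weight
    unchanged, or takes one of |D|-|U|-k fresh ones, each of which multiplies the weight by
    (x-|U|-k)/(|D|-|U|-k). The two cases contribute the factor (|U|+k)+(x-|U|-k) = x. *)
Lemma sum_wt_ord (U : {set D}) m : (m + #|U| <= #|D|)%N ->
  \sum_(e : {ffun 'I_m -> D}) wt U (new_colours U e) = x ^+ m.
Proof.
have UD : (#|U| <= #|D|)%N by exact: max_card.
elim: m => [_|m IH mD].
  rewrite (eq_bigr (fun=> 1)) => [|e _]; first by rewrite sumr_const card_ffun card_ord.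
  have /eqP -> : new_colours U e == 0%N.
    by rewrite -leqn0 -[X in (_ <= X)%N](card_ord 0) new_colours_leq.
  by rewrite /wt /falling !big_ord0 divr1.
rewrite big_fcons exprSr -IH; last exact: ltnW.
rewrite mulr_suml; apply: eq_bigr => e _.
set k := new_colours U e; pose O := U :|: [set c in codom e | c \notin U].
have kO : #|O| = (#|U| + k)%N.
  rewrite cardsU (_ : _ :&: _ = set0) ?cards0 ?subn0 //.
  by apply/setP => c; rewrite !inE andbA andbAC andbN.
have km : (k <= m)%N by rewrite -[X in (_ <= X)%N](card_ord m) new_colours_leq.
have new c : new_colours U (fcons c e) = (k + (c \notin O))%N.
  rewrite /new_colours; have [cO|cO] := boolP (c \in O).
    rewrite addn0; apply: eq_card => y; rewrite !inE codom_fcons.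
    case: eqP => [->|//]; move: cO; rewrite !inE /=.
    by case: (c \in U); rewrite /= ?andbF // andbT => ->.
  rewrite addnC.
  transitivity #|c |: [set c0 in codom e | c0 \notin U]|.
    apply: eq_card => y; rewrite !inE codom_fcons andb_orl; congr orb.
    case: eqP => // ->; move: cO; rewrite !inE negb_or => /andP [-> _] //.
  rewrite cardsU1 !inE; congr (nat_of_bool _ + _)%N.
  by move: cO; rewrite !inE negb_or => /andP [_].
have kD : (k < #|D| - #|U|)%N.
  by rewrite ltn_subRL addnC (leq_trans _ mD) // addSn ltnS leq_add2r km.
have nzf : falling ((#|D| - #|U|)%:R : F) k != 0 by apply: falling_neq0; exact: ltnW.
have nz : (#|D| - #|U|)%:R - k%:R != 0 :> F.
  rewrite -natrB; last exact: ltnW.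
  by move: kD; rewrite -subn_gt0; case: (_ - k)%N.
rewrite (bigID (mem O)) /= (eq_bigr (fun=> wt U k)) => [|c cO]; last by rewrite new cO addn0.
rewrite [X in _ + X](eq_bigr (fun=> wt U k.+1)) => [|c cO]; last first.
  by rewrite new (negbTE cO) addn1.
rewrite !sumr_const kO.
have -> : #|[pred c | c \notin O]| = (#|D| - #|U| - k)%N.
  by rewrite -(cardC (mem O)) kO -subnDA addKn.
rewrite /wt !fallingS -natrB //.
rewrite -[_ *+ (_ + _)]mulr_natr -[_ *+ (_ - _ - _)]mulr_natr natrD (natrB _ (ltnW kD)).
move: nzf nz; set B := falling (_ - _)%:R k; set C := (_ - _)%:R => nzf nz.
by field; rewrite nzf.
Qed.

Lemma sum_wt (U : {set D}) (A : finType) : (#|A| + #|U| <= #|D|)%N ->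
  \sum_(e : {ffun A -> D}) wt U (new_colours U e) = x ^+ #|A|.
Proof.
move=> AD; rewrite -(sum_wt_ord AD) big_ffun_enum_rank; apply: eq_bigr => e _.
congr wt; apply: eq_card => c; rewrite !inE; congr andb.
apply/codomP/codomP => -[a ->]; first by exists (enum_rank a); rewrite ffunE.
by exists (enum_val a); rewrite ffunE enum_valK.
Qed.

End WeightedColourings.

(** * The partition algebra acting on words *)

Section Words.
Variables (r : nat) (D : Type).

Definition word2 (f g : 'I_r -> D) (u : 'I_2 * 'I_r) : D :=
  if u.1 == unb then f u.2 else g u.2.

Definition word3 (f g h : 'I_r -> D) (u : 'I_3 * 'I_r) : D :=
  if u.1 == row0 then f u.2 else if u.1 == row1 then g u.2 else h u.2.

Lemma word3_place2 f g h a : word3 f g h (place row2 a) = word2 f g a.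
Proof. by case: a => [[[|[|//]] i] j]. Qed.
Lemma word3_place0 f g h a : word3 f g h (place row0 a) = word2 g h a.
Proof. by case: a => [[[|[|//]] i] j]. Qed.
Lemma word3_place1 f g h a : word3 f g h (place row1 a) = word2 f h a.
Proof. by case: a => [[[|[|//]] i] j]. Qed.

End Words.

Section Colourings.
Variables (r : nat) (D : finType).
Implicit Types (p q : setpart r) (f g h : {ffun 'I_r -> D}).

Definition compatible p (w : 'I_2 * 'I_r -> D) : bool :=
  [forall u, forall v, same p u v ==> (w u == w v)].

Lemma compatibleP p w : reflect (forall u v, same p u v -> w u = w v) (compatible p w).
Proof.
apply: (iffP forallP) => [H u v uv|H u].
  by have /forallP/(_ v)/implyP/(_ uv)/eqP := H u.
by apply/forallP => v; apply/implyP => uv; rewrite (H _ _ uv).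
Qed.

Lemma compatible_glueP p q f g h :
  reflect (forall u v, connect (glue p q) u v -> word3 f g h u = word3 f g h v)
    (compatible p (word2 f g) && compatible q (word2 g h)).
Proof.
apply: (iffP andP) => [[/compatibleP Hp /compatibleP Hq] u v /connectP [l]|H].
  elim: l u => [|w l IH] u /=; first by move=> _ ->.
  case/andP=> /orP uw wl vl; rewrite -(IH w wl vl) {IH wl vl}.
  case: uw => /existsP [a /existsP [b /and3P [ab /eqP -> /eqP ->]]].
    by rewrite !word3_place2 (Hp _ _ ab).
  by rewrite !word3_place0 (Hq _ _ ab).
split; apply/compatibleP => a b ab.
  rewrite -!(word3_place2 f g h); apply: H; apply: connect1; apply/orP; left.
  by apply/existsP; exists a; apply/existsP; exists b; rewrite ab !eqxx.
rewrite -!(word3_place0 f g h); apply: H; apply: connect1; apply/orP; right.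
by apply/existsP; exists a; apply/existsP; exists b; rewrite ab !eqxx.
Qed.

Definition outer f h : {set D} := [set c in codom (word2 f h)].

Lemma card_outer f h : (#|outer f h| <= 2 * r)%N.
Proof.
rewrite cardsE; apply: leq_trans (leq_image_card _ _) _.
by rewrite card_prod !card_ord.
Qed.

Section Count.
Variables (p q : setpart r) (f h : {ffun 'I_r -> D}) (d0 : D).
Hypothesis comp_st : compatible (stack p q) (word2 f h).

Let Free := [set C in components p q | C \subset middle r].
Let pb := pblock (components p q).

Let pbE u v : (pb u == pb v) = connect (glue p q) u v.
Proof. exact: eq_pblock_class (@connect_glue_equiv r p q) _ _. Qed.
Let mpb u v : (v \in pb u) = connect (glue p q) u v.
Proof. exact: mem_pblock_class (@connect_glue_equiv r p q) _ _. Qed.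
Let compP : partition (components p q) setT.
Proof. by apply: equivalence_partitionP => a b c _ _ _; exact: connect_glue_equiv. Qed.

Let freeP C : C \in Free -> exists i, C = pb (row1, i).
Proof.
rewrite inE => /andP [CP /subsetP Cm]; have [_ tP n0] := and3P compP.
have [C0|[[a i] uC]] := set_0Vmem C; first by rewrite -C0 CP in n0.
have /= := Cm _ uC; rewrite inE /= => /eqP Ea; rewrite Ea in uC.
by exists i; rewrite /pb (def_pblock tP CP uC).
Qed.

Lemma nmid_leq : (nmid p q <= r)%N.
Proof.
rewrite [nmid]unlock -[X in (_ <= X)%N]card_ord.
apply: leq_trans (leq_imset_card (fun i => pb (row1, i)) predT).
by apply/subset_leq_card/subsetP => C /freeP [i ->]; apply: imset_f.
Qed.

(** The colour forced on a component that meets an outer row. The second [f] in [word3 f f h] only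
    fills the middle row, which [v] avoids; a component that yields [d0] lies in [Free]. *)
Let outv C := if [pick v in C :\: middle r] is Some v then word3 f f h v else d0.

Let value (phi : {ffun {C | C \in Free} -> D}) C :=
  if insub C is Some c then phi c else outv C.

Let fill (phi : {ffun {C | C \in Free} -> D}) : {ffun 'I_r -> D} :=
  [ffun i => value phi (pb (row1, i))].

Let outer_eq u v : u \notin middle r -> v \notin middle r -> connect (glue p q) u v ->
  forall g g', word3 f g h u = word3 f g' h v.
Proof.
move=> um vm uv g g'; have [a Ea] := outer_place um; have [b Eb] := outer_place vm.
have /compatibleP/(_ a b) := comp_st; rewrite same_stack /outer_rel -Ea -Eb => /(_ uv).
by rewrite Ea Eb !word3_place1.
Qed.

Let fillE phi u : word3 f (fill phi) h u = value phi (pb u).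
Proof.
have [um|um] := boolP (u \in middle r).
  case: u um => i j; rewrite inE /= => /eqP ->; rewrite /word3 /=.
  by rewrite /fill ffunE.
rewrite /value; case: insubP => [[C CF] /= _ E|_].
  have : u \in C by rewrite E mpb connect0.
  by have := CF; rewrite inE => /andP [_ /subsetP S] /S; rewrite (negbTE um).
rewrite /outv; case: pickP => [v|/(_ u)]; last by rewrite !inE in um *; rewrite mpb connect0 um.
by case/setDP; rewrite mpb => uv vm; rewrite (outer_eq um vm uv (fill phi) f).
Qed.

Let outvP i : pb (row1, i) \notin Free -> exists2 v,
  v \notin middle r & connect (glue p q) (row1, i) v /\ outv (pb (row1, i)) = word3 f f h v.
Proof.
move=> nF; rewrite /outv; case: pickP => [v|N].
  by rewrite !inE mpb => /andP [vm iv]; exists v; rewrite ?inE.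
case/negP: nF; rewrite inE; apply/andP; split.
  by apply: pblock_mem; case/and3P: compP => /eqP -> _ _; rewrite inE.
by apply/subsetP => v vp; apply: contraFT (N v) => vm; rewrite inE vp vm.
Qed.

(** A compatible middle word is the same as a free choice of colour on each component inside the
    middle, since the other components inherit a colour of the outer words. The two have the same
    new colours, so [sum_wt] applies to the set of free components. *)
Lemma sum_wt_glue (F : fieldType) (x : F) :
  (forall n, n.+1%:R != 0 :> F) -> (3 * r <= #|D|)%N ->
  \sum_(g : {ffun 'I_r -> D} | compatible p (word2 f g) && compatible q (word2 g h))
    wt x (outer f h) (new_colours (outer f h) g)
  = x ^+ nmid p q.
Proof.
move=> char0 rD.
have cF : #|{: {C | C \in Free}}| = nmid p q by rewrite card_sig [nmid]unlock.
rewrite -cF -(@sum_wt _ x _ char0 (outer f h)); last first.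
  rewrite cF (leq_trans _ rD) // (mulSn 2) leq_add ?card_outer //; exact: nmid_leq.
rewrite (reindex fill) /=; last first.
  (* The inverse reads the colour at any middle vertex of the free component; [freeP] provides one,
     so [d0] does not occur. *)
  exists (fun g => [ffun c => if [pick i | val c == pb (row1, i)] is Some i then g i else d0]).
    move=> phi _; apply/ffunP => -[C CF]; rewrite ffunE /=.
    case: pickP => [i /eqP E|N]; last by have [i /eqP E] := freeP CF; rewrite N in E.
    by rewrite ffunE /value -E insubT.
  move=> g; rewrite inE => /compatible_glueP H; apply/ffunP => i.
  rewrite ffunE /value; case: insubP => [[C CF] /= _ E|nF].
    rewrite ffunE /=; case: pickP => [j /eqP E'|/(_ i)]; last by rewrite E eqxx.
    have /H : connect (glue p q) (row1, i) (row1, j) by rewrite -pbE -E E'.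
    by [].
  have [v vm [iv ->]] := outvP nF.
  have -> : g i = word3 f g h (row1, i) by [].
  by rewrite (H _ _ iv); move: vm; rewrite inE /word3 => /negbTE ->.
apply: eq_big => [phi|phi _].
  by apply/compatible_glueP => u v; rewrite -pbE !fillE => /eqP ->.
congr wt; apply: eq_card => c; rewrite !inE.
have [_|cU] := boolP (c \in codom (word2 f h)); rewrite ?andbF // !andbT.
apply/codomP/codomP => [[i E]|[[C CF] ->]].
  move: E; rewrite ffunE /value; case: insubP => [C _ _ -> |nF E]; first by exists C.
  have [v vm [_ vE]] := outvP nF; case/negP: cU; rewrite E vE.
  by have [a ->] := outer_place vm; rewrite word3_place1; exact: codom_f.
have [i E] := freeP CF; exists i; rewrite ffunE /value.
by rewrite -E insubT.
Qed.
End Count.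
End Colourings.

Lemma exists_injection (A B : finType) :
  (#|A| <= #|B|)%N -> exists e : A -> B, injective e.
Proof.
move=> AB; exists (fun a => enum_val (widen_ord AB (enum_rank a))) => a b.
by move=> /enum_val_inj /(congr1 val) /= /val_inj /enum_rank_inj.
Qed.

Lemma eq_bar (i : 'I_2) : i != unb -> i = bar.
Proof. by case: i => [[|[|//]] ?] // _; apply: val_inj. Qed.

Lemma word2_rows r (D : finType) (w : 'I_2 * 'I_r -> D) :
  word2 [ffun i => w (unb, i)] [ffun i => w (bar, i)] =1 w.
Proof.
move=> [i j]; rewrite /word2 /=; case: ifPn => [/eqP ->|/eq_bar ->]; exact: ffunE.
Qed.

(** * Set partitions as kernels of words *)

Section Kernel.
Variables (r : nat) (T : eqType).

Fact kerpart_proof (w : 'I_2 * 'I_r -> T) :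
  partition (equivalence_partition (fun u v => w u == w v) [set: 'I_2 * 'I_r])
            [set: 'I_2 * 'I_r].
Proof. by apply: equivalence_partitionP => a b c _ _ _; split=> // /eqP ->. Qed.

Definition kerpart w : setpart r := SetPart (kerpart_proof w).

Lemma same_kerpart w u v : same (kerpart w) u v = (w u == w v).
Proof. by apply: eq_pblock_class => a b c; split=> // /eqP ->. Qed.

Lemma eq_kerpart w w' : w =1 w' -> kerpart w = kerpart w'.
Proof. by move=> E; apply: setpart_inj => u v; rewrite !same_kerpart !E. Qed.

End Kernel.

(** An injection of the 2r vertices into the palette, applied to one chosen vertex per block, gives
    different blocks different colours. *)
Lemma kerpart_onto r (D : finType) (p : setpart r) : (2 * r <= #|D|)%N ->
  exists f : {ffun 'I_r -> D}, exists h : {ffun 'I_r -> D}, kerpart (word2 f h) = p.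
Proof.
move=> rD; have [|e ie] := @exists_injection ('I_2 * 'I_r)%type D.
  by rewrite card_prod !card_ord.
(* The choice depends only on the block of [u]; the default is never taken, since [same p u u]
   holds. *)
pose rep u := odflt u [pick v | same p u v].
have repP u : same p u (rep u).
  by rewrite /rep; case: pickP => //= _; rewrite /same.
pose w u := e (rep u).
exists [ffun i => w (unb, i)]; exists [ffun i => w (bar, i)].
rewrite (eq_kerpart (word2_rows w)); apply: setpart_inj => u v; rewrite same_kerpart /w (inj_eq ie).
apply/eqP/idP => [E'|uv].
  have := repP u; rewrite E' /same => /eqP ->; rewrite eq_sym; exact: repP.
have S : same p u =1 same p v by move=> z; rewrite /same (eqP uv).
rewrite /rep (eq_pick S); case: pickP => //= N.
by have := N v; rewrite /same eqxx.
Qed.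

Section OrbitExpansion.
Variables (F : fieldType) (x : F) (r : nat).

Lemma orbit_expand (u : partalg x r) :
  u = \sum_q (\sum_(p | coarser q p) u p : F) *: orbit x q.
Proof.
rewrite {1}[u]diag_expand (eq_bigr (fun p => \sum_(q | coarser q p) u p *: orbit x q)).
  rewrite (exchange_big_dep xpredT) //=; apply: eq_bigr => q _.
  by rewrite scaler_suml.
by move=> p _; rewrite orbit_sum scaler_sumr.
Qed.

End OrbitExpansion.

(** * Matrix entries of the partition algebra *)

Section Evaluation.
Variables (F : fieldType) (x : F) (r : nat) (D : finType).
Hypothesis char0 : forall n, n.+1%:R != 0 :> F.
Hypothesis rD : (3 * r <= #|D|)%N.
Implicit Types (f g h : {ffun 'I_r -> D}) (u v : partalg x r) (p q : setpart r).

Definition rho f h u : F^o := \sum_p (u p : F) * (compatible p (word2 f h))%:R.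

Fact rho_linear f h : linear (rho f h).
Proof.
move=> c u v; rewrite /rho scaler_sumr -big_split /=; apply: eq_bigr => p _.
by rewrite !ffunE mulrDl -mulrA.
Qed.
HB.instance Definition _ f h := GRing.isLinear.Build F (partalg x r) F^o _
  (rho f h) (rho_linear f h).

Lemma compatible_kerpart p (w : 'I_2 * 'I_r -> D) : compatible p w = coarser (kerpart w) p.
Proof.
by apply/compatibleP/coarserP => H u v uv; [rewrite same_kerpart (H _ _ uv)|
  apply/eqP; rewrite -same_kerpart; exact: H].
Qed.

(** Compared with [orbit_expand], this identifies the entry at (f, h) with the orbit-basis
    coefficient at the kernel of (f, h). *)
Lemma rho_coarser f h u :
  rho f h u = \sum_(p | coarser (kerpart (word2 f h)) p) (u p : F).
Proof.
rewrite /rho [RHS]big_mkcond; apply: eq_bigr => p _; rewrite compatible_kerpart.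
by case: ifP; rewrite ?mulr1 ?mulr0.
Qed.

Lemma rho_diag f h p : rho f h (diag x p) = (compatible p (word2 f h))%:R.
Proof.
rewrite /rho (bigD1 p) //= big1 => [|q qp]; first by rewrite diagE eqxx mul1r addr0.
by rewrite diagE (negbTE qp) mul0r.
Qed.

(** Induction along proper coarsenings: the entry of [diag x p] is the sum of the indicators of q =
    K over all q coarser than p, and the terms with q different from p cancel. *)
Lemma rho_orbit f h p : rho f h (orbit x p) = (p == kerpart (word2 f h))%:R.
Proof.
set K := kerpart _; have [n] := ubnP (ncoarser p); elim: n p => // n IH p lt.
have := rho_diag f h p; rewrite orbit_sum linear_sum /= (bigD1 p) ?coarser_refl //=.
rewrite (eq_bigr (fun q => (q == K)%:R)) => [|q /andP [qp nqp]]; last first.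
  by rewrite IH // (leq_trans (ncoarser_lt qp nqp)).
rewrite compatible_kerpart -/K.
have -> : (coarser K p)%:R = \sum_(q | coarser q p) (q == K)%:R :> F.
  rewrite big_mkcond (bigD1 K) //= eqxx big1 ?addr0; first by case: ifP.
  by move=> q /negbTE ->; case: ifP.
by rewrite [in RHS](bigD1 p) ?coarser_refl //= => /addIr.
Qed.

Lemma rho_inj u v : (forall f h, rho f h u = rho f h v) -> u = v.
Proof.
move=> E; rewrite [u]orbit_expand [v]orbit_expand; apply: eq_bigr => q _.
have [|f [h <-]] := @kerpart_onto r D q.
  by apply: leq_trans rD; rewrite leq_mul2r orbT.
by rewrite -!rho_coarser E.
Qed.

(** By bilinearity it suffices to treat two diagrams. If (f, h) is compatible with their stack,
    [sum_wt_glue] supplies the power of x; otherwise no middle word is compatible with both. *)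
Lemma rhoM (d0 : D) f h u v :
  rho f h (u * v) = \sum_(g : {ffun 'I_r -> D})
    wt x (outer f h) (new_colours (outer f h) g) * (rho f g u * rho g h v).
Proof.
have -> : u * v = partalg_mul u v by [].
rewrite unlock linear_sum /=.
under [LHS]eq_bigr do rewrite linear_sum.
pose t p q (g : {ffun 'I_r -> D}) := wt x (outer f h) (new_colours (outer f h) g) *
  ((compatible p (word2 f g))%:R * (compatible q (word2 g h))%:R).
transitivity (\sum_(g : {ffun 'I_r -> D}) \sum_p \sum_q (u p * v q : F) * t p q g); last first.
  apply: eq_bigr => g _; rewrite /rho big_distrlr big_distrr /=.
  apply: eq_bigr => p _; rewrite big_distrr; apply: eq_bigr => q _ /=.
  by rewrite /t; ring.
rewrite [RHS]exchange_big; apply: eq_bigr => p _.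
rewrite [RHS]exchange_big; apply: eq_bigr => q _ /=.
rewrite !linearZ /= rho_diag -big_distrr /=; congr (_ * _).
have [comp_st|nok] := boolP (compatible (stack p q) (word2 f h)).
  rewrite -[X in X *: _](sum_wt_glue d0 comp_st x char0 rD) [_ *: _]mulr1.
  rewrite big_mkcond; apply: eq_bigr => g _; rewrite /t -natrM mulnb.
  by case: ifP; rewrite ?mulr1 ?mulr0.
rewrite scaler0 big1 // => g _; rewrite /t -natrM mulnb.
case: compatible_glueP => [H|]; last by rewrite mulr0.
case/negP: nok; apply/compatibleP => a b; rewrite same_stack => ab.
by rewrite -!(word3_place1 f g h); exact: H.
Qed.

Definition fperm f (s : 'S_r) : {ffun 'I_r -> D} := [ffun i => f (s i)].

Lemma compatible_perm f h s : compatible (perm_part s) (word2 f h) = (h == fperm f s).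
Proof.
apply/compatibleP/eqP => [H|-> u v].
  apply/ffunP => i; rewrite ffunE; have := H (bar, i) (unb, s i).
  by rewrite same_perm /word2 /= => ->.
rewrite same_perm => E.
have W w : word2 f (fperm f s) w = f (if w.1 == unb then w.2 else s w.2).
  by rewrite /word2; case: ifP => // _; rewrite ffunE.
by rewrite !W (eqP E).
Qed.

Lemma fpermK f s : fperm (fperm f s) s^-1 = f.
Proof. by apply/ffunP => i; rewrite !ffunE permKV. Qed.

Lemma fpermKV f s : fperm (fperm f s^-1) s = f.
Proof. by apply/ffunP => i; rewrite !ffunE permK. Qed.

Lemma wt_outer f h g : {subset codom g <= codom (word2 f h)} ->
  wt x (outer f h) (new_colours (outer f h) g) = 1.
Proof.
move=> S; have -> : new_colours (outer f h) g = 0%N.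
  by apply/eqP; rewrite cards_eq0; apply/eqP/setP => c; rewrite !inE;
    case: (boolP (c \in codom g)) => //= /S ->.
by rewrite /wt /falling !big_ord0 divr1.
Qed.

(** Permutation diagrams act as permutation matrices: a single middle word survives, and its weight
    is 1 because it has no new colour. *)
Lemma rho_perml (d0 : D) f h s u : rho f h (diag x (perm_part s) * u) = rho (fperm f s) h u.
Proof.
rewrite (rhoM d0) (bigD1 (fperm f s)) //= big1 => [|g /negbTE ng]; last first.
  by rewrite rho_diag compatible_perm ng mul0r mulr0.
rewrite rho_diag compatible_perm eqxx mul1r addr0 wt_outer ?mul1r // => c /codomP [i ->].
by apply/codomP; exists (unb, s i); rewrite ffunE.
Qed.

Lemma rho_permr (d0 : D) f h s u :
  rho f h (u * diag x (perm_part s)) = rho f (fperm h s^-1) u.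
Proof.
rewrite (rhoM d0) (bigD1 (fperm h s^-1)) //= big1 => [|g ng]; last first.
  rewrite rho_diag compatible_perm; case: eqP => [E|_]; last by rewrite !mulr0.
  by case/eqP: ng; rewrite E fpermK.
rewrite rho_diag compatible_perm fpermKV eqxx mulr1 addr0 wt_outer ?mul1r // => c /codomP [i ->].
by apply/codomP; exists (bar, (s^-1)%g i); rewrite ffunE.
Qed.

Lemma young_inv k (a : wcomp r k) (s : 'S_r) : ((s^-1)%g \in young a) = (s \in young a).
Proof.
have imp (t : 'S_r) : t \in young a -> (t^-1)%g \in young a.
  rewrite !inE => /forallP H; apply/forallP => i.
  by have := H ((t^-1)%g i); rewrite permKV eq_sym.
by apply/idP/idP => [/imp|/imp //]; rewrite invgK.
Qed.

Lemma rho_sandwich (d0 : D) k (a b : wcomp r k) f h u :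
  rho f h (symmetrizer x a * u * symmetrizer x b) =
  (#|young a|%:R * #|young b|%:R)^-1 *
  \sum_(s in young a) \sum_(t in young b) rho (fperm f s) (fperm h t) u.
Proof.
rewrite /symmetrizer -scalerAr -!scalerAl scalerA linearZ /= -invfM [X in X^-1]mulrC.
congr (_ * _); rewrite !mulr_suml linear_sum; apply: eq_bigr => s _.
(* Multiplication on the right acts on [h] through the inverse permutation; inverting [t] makes both
   sides uniform. *)
rewrite mulr_sumr linear_sum (reindex_inj invg_inj) /=.
apply: eq_big => [t|t _]; first by rewrite young_inv.
by rewrite rho_permr // invgK rho_perml.
Qed.

End Evaluation.

(** * Multiset partitions of words *)

Section Intervals.
Variables (r k : nat).

Lemma reshape_index_cons n sh i :
  reshape_index (n :: sh) i = if (i < n)%N then 0%N else (reshape_index sh (i - n)).+1.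
Proof.
rewrite /reshape_index /=.
case: ltnP => ni; first by move: ni; rewrite -subn_eq0 => /eqP ->; rewrite eqxx.
by rewrite subSn.
Qed.

Lemma count_reshape_index sh j :
  count (fun i => reshape_index sh i == j) (iota 0 (sumn sh)) = nth 0%N sh j.
Proof.
elim: sh j => [|n sh IH] j; first by rewrite nth_nil.
rewrite /= iotaD count_cat add0n -[in iota n _](addn0 n) iotaDl count_map.
rewrite (@eq_in_count _ _ (fun=> 0%N == j)); last first.
  by move=> i; rewrite mem_iota add0n => /= ni; rewrite reshape_index_cons ni.
rewrite [X in (_ + X)%N](@eq_count _ _ (fun i => (reshape_index sh i).+1 == j)); last first.
  by move=> i; rewrite /= reshape_index_cons ltnNge leq_addr /= addKn.
case: j => [|j] /=.
  by rewrite count_predT size_iota (@eq_count _ _ pred0) ?count_pred0 ?addn0.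
by rewrite (@eq_count _ (fun=> 0%N == j.+1) pred0) // count_pred0 IH.
Qed.

Lemma card_interval (a : wcomp r k) j :
  #|[pred t | interval a t == j]| = tnth (wtuple a) j :> nat.
Proof.
have sa : sumn (wseq a) = r by apply/eqP; exact: (valP a).
rewrite (tnth_nth ord0) -(nth_map _ 0%N) ?size_tuple // -count_reshape_index.
rewrite -/(wseq a) sa -sum1_count -[in iota _ _](subn0 r) big_mkord -sum1_card.
by apply: eq_bigl => t; rewrite inE.
Qed.

End Intervals.

Lemma sum_card_fibre (T : finType) (Y : finType) (f : T -> Y) (P : pred T) :
  (\sum_y #|[pred t | (f t == y) && P t]| = #|P|)%N.
Proof.
rewrite -sum1_card (partition_big f predT) //=; apply: eq_bigr => y _.
by rewrite -sum1_card; apply: eq_bigl => t; rewrite !inE andbC.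
Qed.

Section Cells.
Variables (m r k : nat) (D : finType).
Implicit Types (A : 'I_m -> wcomp r k) (w : 'I_m * 'I_r -> D).

Definition letter A (v : 'I_m * 'I_r) : 'I_m * 'I_k := (v.1, interval (A v.1) v.2).

(** The letters of colour [c]. The nonempty cells will be the blocks of the type of [w]. *)
Definition cell A w (c : D) : {mset 'I_m * 'I_k} :=
  seq_mset [seq letter A v | v <- enum [pred v | w v == c]].

Lemma cellE A w c i j :
  cell A w c (i, j) = #|[pred t | (w (i, t) == c) && (interval (A i) t == j)]|.
Proof.
rewrite mset_seqE count_map.
have inj : injective (fun t : 'I_r => (i, t)) by move=> t u [].
rewrite -(card_imset _ inj) -sum1_count big_enum_cond sum1_card /=.
apply: eq_card => -[i' t]; rewrite [LHS]unfold_in /= inE.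
apply/andP/imsetP => [[wc /eqP [E1 E2]]|[u]].
  by subst i'; exists t; rewrite // inE wc E2 eqxx.
by rewrite inE => /andP [wu ju] [-> ->]; rewrite wu /letter (eqP ju).
Qed.

Lemma cell_neq0 A w c : (cell A w c != mset0) = (c \in codom w).
Proof.
apply/idP/idP => [|/codomP [[i t] ->]].
  apply: contraR => N; apply/eqP/msetP => -[i j]; rewrite cellE mset0E.
  by apply: eq_card0 => t; rewrite inE; apply: contraNF N => /andP [/eqP <- _]; exact: codom_f.
apply/eqP => /msetP /(_ (i, interval (A i) t)).
rewrite cellE mset0E => /eqP; rewrite -leqn0 leqNgt => /negP; apply.
by apply/card_gt0P; exists t; rewrite inE !eqxx.
Qed.

Lemma row_size_sum (i : 'I_m) (B : {mset 'I_m * 'I_k}) : row_size i B = (\sum_j B (i, j))%N.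
Proof.
rewrite /row_size -sum1_count (partition_big (fun l : 'I_m * 'I_k => l.2) predT) //=.
apply: eq_bigr => j _; rewrite -count_mem_mset -sum1_count; apply: eq_bigl => l.
by case: l => a b; rewrite /= xpair_eqE.
Qed.

Definition type_blocks A w : {mset {mset 'I_m * 'I_k}} :=
  seq_mset [seq B <- [seq cell A w c | c <- enum D] | B != mset0].

(** A neutral value at [mset0] allows the iteration to run over all colours, used or not. *)
Lemma big_type (R : Type) (idx : R) (op : Monoid.com_law idx) A w (P : {mset _} -> R) :
  P mset0 = idx ->
  \big[op/idx]_(B <- type_blocks A w) P B = \big[op/idx]_c P (cell A w c).
Proof.
move=> P0; rewrite (perm_big _ (perm_eq_seq_mset _)) /= big_filter big_map.
rewrite big_enum_cond /= big_mkcond; apply: eq_bigr => c _.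
by case: eqP => // ->.
Qed.

Lemma type_proof A w :
  (mset0 \notin type_blocks A w) && [forall i, row_count i (type_blocks A w) == r].
Proof.
rewrite (perm_mem (perm_eq_seq_mset _)) mem_filter eqxx /=; apply/forallP => i; apply/eqP.
rewrite /row_count big_type; last by rewrite /row_size enum_mset0.
rewrite -[RHS](card_ord r) -(sum_card_fibre (fun t => w (i, t)) predT); apply: eq_bigr => c _.
rewrite row_size_sum -(sum_card_fibre (interval (A i)) [pred t | (w (i, t) == c) && true]).
by apply: eq_bigr => j _; rewrite cellE; apply: eq_card => t; rewrite !inE andbT andbC.
Qed.

Definition word_type A w : mspart m r k := MSPart (type_proof A w).

Lemma type_mult A w S : S != mset0 -> mblocks (word_type A w) S = #|[pred c | cell A w c == S]|.
Proof.
move=> S0; rewrite mset_seqE count_filter count_map -sum1_count big_enum_cond sum1_card.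
by apply: eq_card => c; rewrite [LHS]unfold_in /= inE; case: eqP => // ->.
Qed.

Lemma size_type A w : size (mblocks (word_type A w)) = #|[set c in codom w]|.
Proof.
rewrite (perm_size (perm_eq_seq_mset _)) size_filter count_map -sum1_count big_enum_cond.
by rewrite sum1_card; apply: eq_card => c; rewrite [LHS]unfold_in /= cell_neq0 inE.
Qed.

Lemma eq_type A A' w w' : A =1 A' -> w =1 w' -> word_type A w = word_type A' w'.
Proof.
move=> EA Ew; apply: val_inj; rewrite /= /type_blocks; congr seq_mset.
congr filter; apply: eq_map => c; apply/msetP => -[i j]; rewrite !cellE.
by apply: eq_card => t; rewrite !inE Ew EA.
Qed.

End Cells.

Lemma drop_blockE m k (h : 'I_m) (B : {mset 'I_m * 'I_k}) l :
  drop_block h B l = B (lift h l.1, l.2).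
Proof.
rewrite mset_seqE -[RHS]count_mem_mset; case: l => i j.
elim: (enum_mset B) => //= -[i' j'] s <-.
case: (unliftP h i') => [i''|] -> /=; first by rewrite !xpair_eqE (inj_eq lift_inj).
by rewrite xpair_eqE eq_liftF.
Qed.

Lemma drop_block_cell m r k (D : finType) (h : 'I_m) (A : 'I_m -> wcomp r k)
    (w : 'I_m * 'I_r -> D) c :
  drop_block h (cell A w c) = cell (fun i => A (lift h i)) (fun v => w (lift h v.1, v.2)) c.
Proof. by apply/msetP => -[i j]; rewrite drop_blockE !cellE. Qed.

Lemma drop_block0 m k (h : 'I_m) : drop_block h (mset0 : {mset 'I_m * 'I_k}) = mset0.
Proof. by apply/msetP => l; rewrite drop_blockE !mset0E. Qed.

(** Restriction acts cell by cell. A colour used only in row [h] gives an empty cell, which both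
    sides discard. *)
Lemma drop_row_type m r k (D : finType) (h : 'I_m) (A : 'I_m -> wcomp r k)
    (w : 'I_m * 'I_r -> D) :
  drop_row h (word_type A w) = word_type (fun i => A (lift h i)) (fun v => w (lift h v.1, v.2)).
Proof.
apply: val_inj; rewrite /= /drop_blocks /type_blocks; apply/eq_seq_msetP.
rewrite (perm_trans (perm_filter _ (perm_map _ (perm_eq_seq_mset _)))) //.
rewrite (_ : [seq _ | c <- enum D] = [seq drop_block h (cell A w c) | c <- enum D]); last first.
  by apply: eq_map => c; rewrite drop_block_cell.
elim: (enum D) => //= c s IH; have [c0|c0] := eqVneq (cell A w c) mset0.
  by rewrite c0 drop_block0 eqxx.
by rewrite /=; case: ifP => //; rewrite perm_cons.
Qed.

Section TwoRows.
Variables (r k : nat) (D : finType).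
Implicit Types (a b d : wcomp r k).

Definition pair2 a b (i : 'I_2) : wcomp r k := if i == unb then a else b.
Definition trip a b d (i : 'I_3) : wcomp r k :=
  if i == row0 then a else if i == row1 then b else d.

Lemma content_type (A : 'I_2 -> wcomp r k) (w : 'I_2 * 'I_r -> D) i :
  content i (word_type A w) = A i.
Proof.
apply: val_inj; apply: eq_from_tnth => j; apply: val_inj; rewrite /= tnth_mktuple.
rewrite -card_interval.
have -> : multiplicity i (word_type A w) j = #|[pred t | interval (A i) t == j]|.
  rewrite /multiplicity big_type ?mset0E // -(sum_card_fibre (fun t => w (i, t))).
  by apply: eq_bigr => c _; rewrite cellE.
by rewrite inordK // ltnS -[X in (_ <= X)%N](card_ord r) max_card.
Qed.

(** The blocks of the kernel are the fibres over the colours in use, and relabelling a fibre gives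
    its cell. *)
Lemma kappa_type a b (w : 'I_2 * 'I_r -> D) : kappa a b (kerpart w) = word_type (pair2 a b) w.
Proof.
apply: val_inj; rewrite /= /kappa_blocks /type_blocks; apply/eq_seq_msetP.
rewrite filter_map.
pose fibre_card c := [set v | w v == c].
have -> : [seq x <- enum D | preim (cell (pair2 a b) w) (fun B => B != mset0) x] =
    [seq c <- enum D | c \in codom w].
  by apply: eq_filter => c; rewrite /= cell_neq0.
have -> : [seq cell (pair2 a b) w i | i <- [seq c <- enum D | c \in codom w]] =
   [seq kappa_block a b B | B <- [seq fibre_card c | c <- enum D & c \in codom w]].
  rewrite -map_comp; apply: eq_map => c /=; congr seq_mset.
  by rewrite /kappa_block; congr map; apply: eq_enum => v; rewrite !inE.
apply: perm_map; apply: uniq_perm; first exact: enum_uniq.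
  rewrite map_inj_in_uniq; first exact: filter_uniq (enum_uniq _).
  move=> c c'.
  rewrite !mem_filter => /andP [/codomP [v ->] _] _ /setP /(_ v).
  by rewrite !inE eqxx => /esym /eqP.
move=> B; rewrite mem_enum; apply/imsetP/mapP => [[v _ ->]|[c]].
  exists (w v); first by rewrite mem_filter codom_f mem_enum.
  by apply/setP => u; rewrite !inE /= eq_sym.
rewrite mem_filter => /andP [/codomP [v ->] _] ->; exists v => //.
by apply/setP => u; rewrite !inE /= eq_sym.
Qed.

End TwoRows.

(** * Counting words and labellings *)

Lemma count_flatten_nseq (T : finType) (n : T -> nat) (P : pred T) :
  count P (flatten [seq nseq (n y) y | y <- enum T]) = (\sum_(y | P y) n y)%N.
Proof.
rewrite count_flatten -map_comp sumnE big_map big_enum /= [RHS]big_mkcond.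
by apply: eq_bigr => y _; rewrite /= count_nseq; case: (P y); rewrite ?mul1n.
Qed.

Lemma sum_bool_card (T : finType) (P Q : pred T) :
  (\sum_(t | P t) Q t = #|[set t | P t && Q t]|)%N.
Proof. by rewrite -sum1dep_card big_mkcondr; apply: eq_bigr => t _; case: (Q t). Qed.

Section YoungCounting.
Variables (r k : nat) (D : finType) (a : wcomp r k).
Implicit Types (g : {ffun 'I_r -> D}) (n : D -> 'I_k -> nat).

Definition fibre_card g c j : nat := #|[pred t | (g t == c) && (interval a t == j)]|.

Definition fits n g := [forall c, forall j, fibre_card g c j == n c j].

Lemma fitsP n g : reflect (forall c j, fibre_card g c j = n c j) (fits n g).
Proof.
apply: (iffP forallP) => [H c j|H c]; first by have /forallP/(_ j)/eqP := H c.
by apply/forallP => j; rewrite H.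
Qed.

Lemma fibre_card_perm g (s : 'S_r) c j :
  s \in young a -> fibre_card (fperm g s) c j = fibre_card g c j.
Proof.
rewrite inE => /forallP H; rewrite /fibre_card -[LHS](card_imset _ (@perm_inj _ s)).
apply: eq_card => t; rewrite !inE; apply/imsetP/idP => [[u]|].
  by rewrite inE ffunE => /andP [E1 E2] ->; rewrite E1 (eqP (H u)) E2.
move=> E; exists ((s^-1)%g t); rewrite ?permKV // inE ffunE permKV.
by have := H ((s^-1)%g t); rewrite permKV => /eqP <-.
Qed.

(** Such permutations are the injections of positions that respect the pair (colour, interval).
    Corresponding fibres have equal size, so each falling factorial is a full factorial. *)
Lemma card_young_transporter g g' : fits (fibre_card g) g' ->
  (\sum_(s in young a) (fperm g s == g') = \prod_c \prod_j (fibre_card g c j)`!)%N.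
Proof.
move=> /fitsP G.
pose G1 t := (g t, interval a t); pose d t := (g' t, interval a t).
have := @card_inj_over _ _ G1 _ d (index_enum _) (index_enum_uniq _)
  (fun _ => mem_index_enum _).
rewrite (eq_bigr (fun y => (fibre_card g y.1 y.2)`!)%N) => [|[c j] _]; last first.
  have -> : #|[pred t | G1 t == (c, j)]| = fibre_card g c j.
    by apply: eq_card => t; rewrite !inE xpair_eqE.
  have -> : #|[pred t | d t == (c, j)]| = fibre_card g' c j.
    by apply: eq_card => t; rewrite !inE xpair_eqE.
  by rewrite G ffactnn.
rewrite pair_bigA => <-.
rewrite !sum_bool_card.
have inj : injective (fun s : 'S_r => [ffun i => s i]).
  by move=> s t /ffunP E; apply/permP => i; have := E i; rewrite !ffunE.
rewrite -(card_imset _ inj); apply: eq_card => e; rewrite inE /=.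
apply/imsetP/inj_overP => [[s]|[I H]].
  rewrite !inE => /andP [/forallP Y /eqP E] ->; split=> [i j|i].
    by rewrite !ffunE => /perm_inj.
  by rewrite /G1 /d -E !ffunE (eqP (Y i)).
exists (perm I); last by apply/ffunP => i; rewrite ffunE permE.
rewrite !inE; apply/andP; split.
  by apply/forallP => i; rewrite permE; have /= -> := congr1 snd (H i).
by apply/eqP/ffunP => i; rewrite ffunE permE; have /= -> := congr1 fst (H i).
Qed.

(** List each pair (c, j) with multiplicity [n c j]. The second coordinates form the same multiset
    as the intervals of the positions, so a permutation aligns them, and the word reads off the
    first coordinates. *)
Lemma fits_exists n : (forall j, \sum_c n c j = #|[pred t | interval a t == j]|)%N ->
  exists g, fits n g.
Proof.
move=> H.
pose s := flatten [seq nseq (n y.1 y.2) y | y : D * 'I_k].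
have cnt P : count P s = (\sum_(y | P y) n y.1 y.2)%N.
  exact: (count_flatten_nseq (fun y : D * 'I_k => n y.1 y.2)).
have ss : size s == r.
  rewrite -count_predT cnt -(pair_bigA _ n) exchange_big /= -[r in _ == r]card_ord.
  rewrite -(sum_card_fibre (interval a) predT); apply/eqP/eq_bigr => j _; rewrite H.
  by apply: eq_card => t; rewrite !inE andbT.
pose S : r.-tuple (D * 'I_k) := Tuple ss.
have /tuple_permP [p E] : perm_eq [seq interval a t | t <- enum 'I_r] [tuple of map snd S].
  apply/seq.permP => P; rewrite count_map [in RHS]count_map cnt -sum1_count big_enum_cond /=.
  rewrite (partition_big (interval a) P) //=.
  rewrite -(pair_big_dep xpredT (fun _ => P) (fun c j => n c j)) /=.
  rewrite exchange_big /=; apply: eq_bigr => j Pj; rewrite H -sum1_card.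
  by apply: eq_bigl => t; rewrite !inE; case: eqP => [->|]; rewrite ?Pj ?andbF.
have Ei t : interval a t = (tnth S (p t)).2.
  rewrite -tnth_map -[RHS](tnth_mktuple (fun i => tnth _ (p i))).
  rewrite (tnth_nth (interval a t)) -E (nth_map t) ?size_enum_ord ?nth_ord_enum //.
exists [ffun t => (tnth S (p t)).1]; apply/fitsP => c j.
rewrite /fibre_card.
have -> : n c j = count_mem (c, j) S.
  by rewrite cnt (big_pred1 (c, j)).
rewrite -[X in count _ X]map_tnth_enum count_map -sum1_count big_enum_cond /= sum1_card.
rewrite -[LHS](card_imset _ (@perm_inj _ p)); apply: eq_card => t.
rewrite [RHS]unfold_in /=; apply/imsetP/idP => [[u]|Et]; first by rewrite inE ffunE Ei => E' ->.
by exists ((p^-1)%g t); rewrite ?permKV // inE ffunE Ei permKV.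
Qed.

(** Orbit-stabiliser: the words with prescribed counts form one orbit of the Young subgroup, and
    each is reached from [g0] by the same number of permutations. *)
Lemma card_fits n : (forall j, \sum_c n c j = #|[pred t | interval a t == j]|)%N ->
  (#|[set g | fits n g]| * \prod_c \prod_j (n c j)`! = #|young a|)%N.
Proof.
move=> /fits_exists [g0 /fitsP G0].
have E : fits (fibre_card g0) =1 fits n.
  by move=> g; apply/fitsP/fitsP => G c j; rewrite G ?G0.
transitivity (\sum_(g | fits (fibre_card g0) g) \sum_(s in young a) (fperm g0 s == g))%N.
  rewrite (eq_bigr _ (fun g => @card_young_transporter g0 g)) sum_nat_const.
  congr (_ * _)%N; first by apply: eq_card => g; rewrite inE -E.
  by apply: eq_bigr => c _; apply: eq_bigr => j _; rewrite G0.
rewrite exchange_big -sum1_card; apply: eq_bigr => s sy.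
rewrite (bigD1 (fperm g0 s)) /=; last by apply/fitsP => c j; rewrite fibre_card_perm.
by rewrite eqxx big1 // => g /andP [_ /negbTE]; rewrite eq_sym => ->.
Qed.

End YoungCounting.

Lemma sum_row_size (m r k : nat) (P : mspart m r k) i :
  (\sum_(B <- mblocks P) row_size i B = r)%N.
Proof. by have /andP [_ /forallP/(_ i)/eqP] := valP P. Qed.

Lemma mspart_neq0 (m r k : nat) (P : mspart m r k) B : B \in mblocks P -> B != mset0.
Proof.
move=> BP; have /andP [n0 _] := valP P; case: eqP => // B0.
by case/negP: n0; move: BP; rewrite B0.
Qed.

Section Labellings.
Variables (m r k : nat) (D : finType) (A : 'I_m -> wcomp r k) (w : 'I_m * 'I_r -> D).
Variables (L : finType) (C : L -> {mset 'I_m * 'I_k}) (P : mspart m r k).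
Hypothesis PC : mblocks P = seq_mset [seq C l | l <- enum L].

Lemma label_mult S : mblocks P S = #|[pred l | C l == S]|.
Proof.
rewrite PC mset_seqE count_map -sum1_count big_enum_cond /= sum1_card.
by apply: eq_card => l; rewrite inE.
Qed.

Lemma label_mem l : C l \in mblocks P.
Proof.
by rewrite -mset_neq0 label_mult -lt0n; apply/card_gt0P; exists l; rewrite inE.
Qed.

(** In every row the blocks of [P] and the cells of [w] both total r letters. The cells at labelled
    colours use up all of them. *)
Lemma labelling_cell0 (e : {ffun L -> D}) c :
  inj_over (cell A w) C e -> c \notin codom e -> cell A w c = mset0.
Proof.
case/inj_overP => I H ce.
have z i : row_size i (cell A w c) = 0%N.
  have := sum_row_size (word_type A w) i; rewrite big_type; last by rewrite /row_size enum_mset0.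
  rewrite -{2}(sum_row_size P i) PC (perm_big _ (perm_eq_seq_mset _)) big_map big_enum /=.
  rewrite (bigID (mem (e @: predT))) /= big_imset /=; last by move=> l l' _ _; exact: I.
  rewrite (eq_bigr _ (fun l _ => congr1 (row_size i) (H l))).
  move/eqP; rewrite -[X in _ == X]addn0 eqn_add2l sum_nat_eq0 => /forall_inP/(_ c) Z.
  by apply/eqP/Z; apply: contra ce => /imsetP [l _ ->]; exact: codom_f.
apply/msetP => -[i j]; rewrite mset0E; have := z i; rewrite row_size_sum => /eqP.
by rewrite sum_nat_eq0 => /forallP/(_ j)/implyP/(_ isT)/eqP.
Qed.

Lemma labelling_type (e : {ffun L -> D}) : inj_over (cell A w) C e -> P = word_type A w.
Proof.
move=> eC; have /inj_overP [I H] := eC; apply: val_inj; apply/msetP => S /=.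
have [->|S0] := eqVneq S mset0.
  have /andP [n0 _] := valP P; have /andP [t0 _] := type_proof A w.
  by rewrite (mset_eq0P n0) (mset_eq0P t0).
rewrite -[RHS]/(mblocks (word_type A w) S) type_mult // label_mult -(card_imset _ I).
apply: eq_card => c; rewrite inE; apply/imsetP/idP => [[l]|/eqP cS].
  by rewrite inE -H => lS ->.
have /codomP [l E] : c \in codom e.
  by apply: contraNT S0 => ce; rewrite -cS (labelling_cell0 eC).
by exists l => //; rewrite inE -H -E cS.
Qed.

(** Turns an indicator of equality of types into a count of injections, which can be exchanged with
    sums over words. A labelling exists only if the types agree, and it then permutes equal blocks
    freely. *)
Lemma card_labellings :
  (\sum_(e : {ffun L -> D}) inj_over (cell A w) C e = (P == word_type A w) * mfact (mblocks P))%N.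
Proof.
have [E|N] := eqVneq P (word_type A w); last first.
  rewrite big1 // => e _; case: (boolP (inj_over _ _ _)) => // /labelling_type E.
  by rewrite E eqxx in N.
rewrite mul1n (@card_inj_over _ _ _ _ _ (undup (mblocks P))) ?undup_uniq //; last first.
  by move=> l; rewrite mem_undup label_mem.
apply: eq_big_seq => S; rewrite mem_undup => SP.
have S0 := mspart_neq0 SP.
by rewrite -type_mult // -E -label_mult ffactnn.
Qed.

End Labellings.

Lemma cell_row (m r k : nat) (D : finType) (A : 'I_m -> wcomp r k) (w : 'I_m * 'I_r -> D)
    (g : {ffun 'I_r -> D}) i c j :
  (forall t, w (i, t) = g t) -> cell A w c (i, j) = fibre_card (A i) g c j.
Proof. by move=> E; rewrite cellE /fibre_card; apply: eq_card => t; rewrite !inE E. Qed.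

Lemma sum_young_transporter (r k : nat) (D : finType) (a : wcomp r k)
    (g g' : {ffun 'I_r -> D}) :
  (\sum_(s in young a) (fperm g s == g') =
   fits a (fibre_card a g) g' * \prod_c \prod_j (fibre_card a g c j)`!)%N.
Proof.
have [G|G] := boolP (fits _ _ _); first by rewrite mul1n card_young_transporter.
rewrite big1 // => s sy; case: eqP => // E; case/negP: G; rewrite -E.
by apply/fitsP => c j; rewrite fibre_card_perm.
Qed.

(** * Averaging over two Young subgroups *)

Section SumYoungKer.
Variables (r k : nat) (D : finType) (a b : wcomp r k).
Variables (f h : {ffun 'I_r -> D}) (p : setpart r).
Local Notation W := (word2 f h).
Local Notation AB := (pair2 a b).

Local Notation L := {B | B \in blocks p}.

Fact block_of_proof u : pblock p u \in blocks p.
Proof. by apply: pblock_mem; have /and3P [/eqP -> _ _] := setpartP p; rewrite inE. Qed.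

Let bl u : L := exist (fun B => B \in blocks p) _ (block_of_proof u).

Let blE u v : (bl u == bl v) = same p u v.
Proof. by []. Qed.

Let labels_kappa :
  mblocks (kappa a b p) = seq_mset [seq kappa_block a b (val l) | l <- enum {: L}].
Proof.
rewrite /= /kappa_blocks; apply/eq_seq_msetP.
rewrite (map_comp (kappa_block a b) val); apply: perm_map.
apply: uniq_perm; rewrite ?enum_uniq ?(map_inj_uniq val_inj) ?enum_uniq // => B.
rewrite mem_enum; apply/idP/mapP => [Bp|[l _ ->]]; last exact: (valP l).
by exists (exist _ B Bp); rewrite ?mem_enum.
Qed.

Definition word_of (e : {ffun L -> D}) u := e (bl u).

Let bl_onto (l : L) : exists u, l = bl u.
Proof.
case: l => B Bp; have /and3P [_ tp n0] := setpartP p.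
have [B0|[u uB]] := set_0Vmem B; first by rewrite -B0 Bp in n0.
by exists u; apply: val_inj; rewrite /= (def_pblock tp Bp uB).
Qed.

Let cell_word_of (e : {ffun L -> D}) l :
  injective e -> cell AB (word_of e) (e l) = kappa_block a b (val l).
Proof.
move=> I; rewrite /cell /kappa_block; congr seq_mset; rewrite /letter.
congr map; apply: eq_enum => u; rewrite inE /word_of (inj_eq I).
have /and3P [/eqP cp tp n0] := setpartP p.
have [v ->] := bl_onto l; rewrite blE /same eq_pblock ?cp ?inE //=.
by rewrite -eq_pblock ?cp ?inE // eq_sym eq_pblock ?cp ?inE.
Qed.

Let ker_word_of (e : {ffun L -> D}) : injective e -> kerpart (word_of e) = p.
Proof. by move=> I; apply: setpart_inj => u v; rewrite same_kerpart (inj_eq I) blE. Qed.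

(** A word with kernel [p] comes from exactly one injective colouring of the blocks of [p]. *)
Let sum_word_of (w : 'I_2 * 'I_r -> D) :
  (p == kerpart w =
   \sum_(e : {ffun L -> D}) (injectiveb e && [forall u, word_of e u == w u]) :> nat)%N.
Proof.
case: eqP => [E|N]; last first.
  rewrite big1 // => e _; case: injectiveP => //= I; case: forallP => // H.
  case: N; rewrite -(ker_word_of I); apply: eq_kerpart => u; exact/eqP.
have bl_onto' l : exists u, l == bl u by have [u ->] := bl_onto l; exists u.
pose e0 : {ffun L -> D} := [ffun l => w (xchoose (bl_onto' l))].
have e0E u : word_of e0 u = w u.
  rewrite /word_of ffunE; apply/eqP; rewrite -same_kerpart -E -blE eq_sym.
  exact: (xchooseP (bl_onto' (bl u))).
rewrite (bigD1 e0) //= big1 => [|e ne]; last first.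
  case: forallP => [H|]; rewrite ?andbF //; case/eqP: ne; apply/ffunP => l.
  by have [u ->] := bl_onto l; rewrite -![_ (bl u)]/(word_of _ u) e0E; exact/eqP.
rewrite addn0; have -> : injectiveb e0.
  apply/injectiveP => l l'; have [u ->] := bl_onto l; have [v ->] := bl_onto l'.
  rewrite -![e0 _]/(word_of e0 _) !e0E => /eqP; rewrite -same_kerpart -E -blE.
  by move/eqP.
by rewrite (_ : [forall u, _]) //; apply/forallP => u; rewrite e0E.
Qed.

(** For injective [e] the cells of [word_of e] at its labels are the blocks of the kappa image, so
    prescribing the counts of both rows amounts to prescribing these cells. *)
Let inj_over_fits (e : {ffun L -> D}) : injectiveb e &&
    (fits a (fibre_card a f) [ffun i => word_of e (unb, i)] &&
     fits b (fibre_card b h) [ffun i => word_of e (bar, i)])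
  = inj_over (cell AB W) (fun l => kappa_block a b (val l)) e.
Proof.
have c0 c j : cell AB W c (unb, j) = fibre_card a f c j by exact: cell_row.
have c1 c j : cell AB W c (bar, j) = fibre_card b h c j by exact: cell_row.
have d0 c j : cell AB (word_of e) c (unb, j) = fibre_card a [ffun i => word_of e (unb, i)] c j.
  by apply: cell_row => t; rewrite ffunE.
have d1 c j : cell AB (word_of e) c (bar, j) = fibre_card b [ffun i => word_of e (bar, i)] c j.
  by apply: cell_row => t; rewrite ffunE.
apply/andP/idP => [[/injectiveP I /andP [/fitsP f0 /fitsP f1]]|H].
  apply/inj_overP; split=> // l; rewrite -(cell_word_of l I).
  apply/msetP => -[i j]; have [->|/eq_bar ->] := eqVneq i unb.
    by rewrite c0 d0 f0.
  by rewrite c1 d1 f1.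
have /inj_overP [I Hl] := H; split; first exact/injectiveP.
have E c : cell AB (word_of e) c = cell AB W c.
  have [/codomP [l ->]|ce] := boolP (c \in codom e); first by rewrite cell_word_of ?Hl.
  rewrite (labelling_cell0 labels_kappa H ce); apply/eqP; rewrite -[_ == _]negbK cell_neq0.
  by apply: contra ce => /codomP [u ->]; exact: codom_f.
by apply/andP; split; apply/fitsP => c j; rewrite -?d0 -?d1 E ?c0 ?c1.
Qed.

(** For a fixed colouring [e] of the blocks the sums over [s] and [t] separate into two transporter
    counts. The colourings for which both are nonzero are the labellings counted by
    [card_labellings]. *)
Lemma sum_young_ker :
  (\sum_(s in young a) \sum_(t in young b)
     (p == kerpart (word2 (fperm f s) (fperm h t))) =
   (kappa a b p == word_type AB W) * mfact (mblocks (kappa a b p)) *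
   ((\prod_c \prod_j (fibre_card a f c j)`!) * \prod_c \prod_j (fibre_card b h c j)`!))%N.
Proof.
rewrite -(card_labellings AB W labels_kappa) big_distrl /=.
under eq_bigr => s _ do under eq_bigr => t _ do rewrite sum_word_of.
under eq_bigr do rewrite exchange_big.
rewrite exchange_big; apply: eq_bigr => e _ /=; rewrite -inj_over_fits -!mulnb -mulnA mulnACA.
rewrite -!sum_young_transporter big_distrlr big_distrr /=; apply: eq_bigr => s _.
rewrite big_distrr; apply: eq_bigr => t _ /=; rewrite !mulnb; congr nat_of_bool; congr andb.
apply/forallP/andP => [H|[/eqP E0 /eqP E1] [i j]].
  by split; apply/eqP/ffunP => i; rewrite [RHS]ffunE;
    [rewrite (eqP (H (unb, i)))|rewrite (eqP (H (bar, i)))].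
rewrite E0 E1 (word2_rows (word_of e)) //.
Qed.

End SumYoungKer.

(** * Normalising factors *)

Section MultisetFactorials.

Lemma mfact_fin (K : finType) (M : {mset K}) : mfact M = (\prod_y (M y)`!)%N.
Proof.
rewrite /mfact [RHS](bigID (mem (undup M))) /= [X in (_ * X)%N]big1 ?muln1; last first.
  by move=> y; rewrite mem_undup => /mset_eq0P ->.
rewrite -(@big_uniq _ _ _ _ (undup M)) ?undup_uniq //.
Qed.

Lemma mfact_row (m k : nat) (i : 'I_m) (B : {mset 'I_m * 'I_k}) :
  mfact (seq_mset [seq l <- B | l.1 == i]) = (\prod_j (B (i, j))`!)%N.
Proof.
have E l : seq_mset [seq l <- B | l.1 == i] l = if l.1 == i then B l else 0%N.
  rewrite mset_seqE count_filter -[B l]count_mem_mset.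
  case: ifP => li; last first.
    by rewrite (@eq_count _ _ pred0) ?count_pred0 // => l' /=; case: eqP => // ->; rewrite li.
  by apply: eq_count => l' /=; case: eqP => // ->; rewrite li.
rewrite mfact_fin (eq_bigr (fun l => (if l.1 == i then B (l.1, l.2) else 0%N)`!)%N); last first.
  by move=> [i' j] _; rewrite E.
rewrite -(pair_bigA _ (fun i' j => (if i' == i then B (i', j) else 0%N)`!)%N) /=.
rewrite (bigD1 i) //= [X in (_ * X)%N]big1 ?muln1 => [|i' /negbTE ->]; last by rewrite big1.
by rewrite eqxx.
Qed.

Lemma mfact_filter (K : choiceType) (M : {mset K}) (P : pred K) :
  mfact (seq_mset [seq y <- M | P y]) = (\prod_(y <- undup M | P y) (M y)`!)%N.
Proof.
have E y : seq_mset [seq z <- M | P z] y = if P y then M y else 0%N.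
  rewrite mset_seqE count_filter -[M y]count_mem_mset; case: ifP => Py.
    by apply: eq_count => z /=; case: eqP => // ->; rewrite Py.
  by rewrite (@eq_count _ _ pred0) ?count_pred0 // => z /=; case: eqP => // ->; rewrite Py.
rewrite /mfact -[RHS]big_filter; rewrite (perm_big [seq y <- undup M | P y]) /=.
  apply: eq_big_seq => y; rewrite mem_filter => /andP [Py _].
  by rewrite E Py.
apply: uniq_perm; rewrite ?undup_uniq ?filter_uniq ?undup_uniq // => y.
by rewrite mem_undup (perm_mem (perm_eq_seq_mset _)) !mem_filter mem_undup.
Qed.

End MultisetFactorials.

(** For the type of a word this is the order of the stabiliser of its row [i] in the Young
    subgroup. *)
Definition rowfact (m r k : nat) (i : 'I_m) (P : mspart m r k) : nat :=
  (\prod_(B <- mblocks P) \prod_j (B (i, j))`!)%N.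

Lemma rowfact_type (m r k : nat) (D : finType) (A : 'I_m -> wcomp r k)
    (w : 'I_m * 'I_r -> D) (g : {ffun 'I_r -> D}) i :
  (forall t, w (i, t) = g t) ->
  rowfact i (word_type A w) = (\prod_c \prod_j (fibre_card (A i) g c j)`!)%N.
Proof.
move=> E; rewrite /rowfact big_type; last by rewrite big1 // => j _; rewrite mset0E.
by apply: eq_bigr => c _; apply: eq_bigr => j _; rewrite (cell_row _ _ _ E).
Qed.

Lemma omegaE (r k : nat) (F : fieldType) (pt : mspart 2 r k) :
  omega F pt =
  (mfact (mblocks pt))%:R / #|young (content unb pt)|%:R * (rowfact bar pt)%:R.
Proof.
rewrite /omega /rowfact natr_prod; congr (_ * _).
by apply: eq_bigr => B _; rewrite mfact_row.
Qed.

Section SandwichedOrbit.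
Variables (F : fieldType) (x : F) (r k : nat) (D : finType) (d0 : D).
Hypothesis char0 : forall n, n.+1%:R != 0 :> F.
Hypothesis rD : (3 * r <= #|D|)%N.

(** The right-hand side sees (f, h) only through its type; this is why entries of corner elements
    are functions of the type. *)
Lemma rho_sandwich_orbit (a b : wcomp r k) (f h : {ffun 'I_r -> D}) p :
  let T := word_type (pair2 a b) (word2 f h) in
  rho f h (symmetrizer x a * orbit x p * symmetrizer x b) =
  (kappa a b p == T)%:R * (mfact (mblocks T) * rowfact unb T * rowfact bar T)%:R /
    (#|young a|%:R * #|young b|%:R).
Proof.
move=> T; rewrite (rho_sandwich char0 rD d0) [RHS]mulrC; congr (_ * _).
rewrite (@rowfact_type 2 r k D _ _ f unb) // (@rowfact_type 2 r k D _ _ h bar) //.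
rewrite -natrM -mulnA [in RHS]mulnA.
have -> : ((kappa a b p == T) * mfact (mblocks T) =
    (kappa a b p == T) * mfact (mblocks (kappa a b p)))%N by case: eqP => // ->.
have /= E := sum_young_ker a b f h p; rewrite -E natr_sum; apply: eq_bigr => s _.
by rewrite natr_sum; apply: eq_bigr => t _; rewrite rho_orbit.
Qed.

End SandwichedOrbit.

(** * Restricting multiset partitions on three rows *)

Section DropRow.
Variables (m r k : nat) (h : 'I_m) (P : mspart m r k).

Lemma drop_row_mult S : S != mset0 ->
  mblocks (drop_row h P) S = count (fun B => drop_block h B == S) (mblocks P).
Proof.
move=> S0; rewrite mset_seqE count_filter count_map; apply: eq_count => B /=.
by case: eqP => // ->.
Qed.

Lemma drop_row_mem B : B \in mblocks P -> drop_block h B != mset0 ->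
  drop_block h B \in mblocks (drop_row h P).
Proof.
move=> BP B0; rewrite -mset_neq0 drop_row_mult // -lt0n -has_count; apply/hasP.
by exists B.
Qed.

Lemma big_drop_row (R : Type) (idx : R) (op : Monoid.com_law idx) (G : {mset _} -> R) :
  G mset0 = idx ->
  \big[op/idx]_(B <- mblocks (drop_row h P)) G B =
  \big[op/idx]_(B <- mblocks P) G (drop_block h B).
Proof.
move=> G0; rewrite (perm_big _ (perm_eq_seq_mset _)) /= big_filter big_map big_mkcond.
by apply: eq_bigr => B _; case: eqP => // ->.
Qed.

Lemma all_row (B : {mset 'I_m * 'I_k}) :
  all (fun l : 'I_m * 'I_k => l.1 == h) B = (drop_block h B == mset0).
Proof.
apply/allP/eqP => [H|H [i j] lB].
  apply/msetP => l; rewrite drop_blockE mset0E; apply/mset_eq0P/negP => /H /=.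
  by rewrite eq_sym (negbTE (neq_lift h l.1)).
rewrite /=; case: (unliftP h i) => [i' E|->] //.
by move: lB; rewrite -mset_neq0 E -(drop_blockE h B (i', j)) H mset0E.
Qed.

End DropRow.

Section ThreeRows.
Variables (r k : nat).
Implicit Type G : mspart 3 r k.

Lemma multiplicity_row1 G j :
  multiplicity bar (drop_row row2 G) j =
  (\sum_(B <- mblocks G) (B : {mset 'I_3 * 'I_k}) (row1, j))%N.
Proof.
rewrite /multiplicity (@big_drop_row 3 r k row2 G) ?mset0E //; apply: eq_bigr => B _.
apply: etrans (drop_blockE (row2 : 'I_3) B (bar, j)) _.
by congr (fun_of_fsfun B (_, _)); apply: val_inj.
Qed.

Lemma content_row1 G j :
  (\sum_(B <- mblocks G) (B : {mset 'I_3 * 'I_k}) (row1, j))%N =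
  #|[pred t | interval (content bar (drop_row row2 G)) t == j]|.
Proof.
rewrite card_interval -multiplicity_row1 /= tnth_mktuple inordK // ltnS.
by rewrite -[leqRHS](sum_multiplicity bar (drop_row row2 G)) (bigD1 j) //= leq_addr.
Qed.

Lemma size_fibre G S : size (fibre G S) = count (fun B => drop_block row1 B == S) (mblocks G).
Proof. by rewrite (perm_size (perm_eq_seq_mset _)) size_filter. Qed.

Lemma size_middle_blocks G :
  size (middle_blocks G) = count (fun B => drop_block row1 B == mset0) (mblocks G).
Proof.
by rewrite (perm_size (perm_eq_seq_mset _)) size_filter; apply: eq_count => B; rewrite all_row.
Qed.

Lemma size_middle_leq G : (size (middle_blocks G) <= r)%N.
Proof.
rewrite size_middle_blocks -sum1_count -[X in (_ <= X)%N](sum_row_size G row1).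
rewrite big_mkcond /= !big_seq.
apply: leq_sum => B BG; case: ifP => // B0.
have /eqP := etrans (all_row row1 B) B0; rewrite eqb_id all_count /row_size => /eqP ->.
rewrite lt0n; apply: contraNneq (mspart_neq0 BG) => /size0nil Bn.
by rewrite -(seq_mset_id B) Bn; apply/eqP/msetP => l; rewrite mset_seqE mset0E.
Qed.

(** The list contains all restrictions of blocks to the outer rows; [mset0] stands for the purely
    barred blocks. *)
Lemma middle_or_drop G B : B \in mblocks G ->
  drop_block row1 B \in mset0 :: undup (mblocks (drop_row row1 G)).
Proof.
move=> BG; rewrite inE mem_undup; have := @drop_row_mem _ _ _ row1 G B BG.
by case: (drop_block row1 B == mset0) => //= ->.
Qed.

Lemma uniq_drop_row G : uniq (mset0 :: undup (mblocks (drop_row row1 G))).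
Proof.
rewrite cons_uniq undup_uniq andbT mem_undup; apply/negP => H.
by have := @mspart_neq0 _ _ _ (drop_row row1 G) _ H; rewrite eqxx.
Qed.

(** Grouping equal blocks by their outer restriction shows that m(G)! is the product of the
    denominators of a_G and b_G. *)
Lemma mfact_fibres G :
  (mfact (mblocks G) = mfact (middle_blocks G) *
     \prod_(S <- undup (mblocks (drop_row row1 G))) mfact (fibre G S))%N.
Proof.
have mid : mfact (middle_blocks G) = mfact (fibre G mset0).
  by congr mfact; congr seq_mset; apply: eq_filter => B; rewrite all_row.
move: (uniq_drop_row G) (@middle_or_drop G); set s := _ :: _ => us ms.
transitivity (\prod_(S <- s) mfact (fibre G S))%N; last by rewrite mid big_cons.
move: (s) us ms => {mid}s us ms.
under eq_bigr do rewrite mfact_filter.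
rewrite (exchange_big_dep xpredT) //=; apply: eq_big_seq => B; rewrite mem_undup => BG.
rewrite -big_filter (bigD1_seq (drop_block row1 B)) /=; last 2 first.
- by rewrite mem_filter eqxx; exact: ms.
- exact: filter_uniq.
rewrite big_filter_cond big1 ?muln1 // => S /andP [/eqP <-].
by rewrite eqxx.
Qed.

Lemma type_row1 (D : finType) (a b d : wcomp r k) (f g h : {ffun 'I_r -> D}) :
  drop_row row1 (word_type (trip a b d) (word3 f g h)) = word_type (pair2 a d) (word2 f h).
Proof.
rewrite drop_row_type; apply: eq_type => [i|u]; last by rewrite -(word3_place1 f g h).
by have [->|/eq_bar ->] := eqVneq i unb.
Qed.

Lemma type_row2 (D : finType) (a b d : wcomp r k) (f g h : {ffun 'I_r -> D}) :
  drop_row row2 (word_type (trip a b d) (word3 f g h)) = word_type (pair2 a b) (word2 f g).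
Proof.
rewrite drop_row_type; apply: eq_type => [i|u]; last by rewrite -(word3_place2 f g h).
by have [->|/eq_bar ->] := eqVneq i unb.
Qed.

Lemma type_row0 (D : finType) (a b d : wcomp r k) (f g h : {ffun 'I_r -> D}) :
  drop_row row0 (word_type (trip a b d) (word3 f g h)) = word_type (pair2 b d) (word2 g h).
Proof.
rewrite drop_row_type; apply: eq_type => [i|u]; last by rewrite -(word3_place0 f g h).
by have [->|/eq_bar ->] := eqVneq i unb.
Qed.

End ThreeRows.

(** * Counting middle words of a given type *)

Lemma card_tnth_count (T : eqType) (s : seq T) (P : pred T) :
  #|[pred l | P (tnth (in_tuple s) l)]| = count P s.
Proof.
rewrite -[X in count _ X](map_tnth_enum (in_tuple s)) count_map -sum1_count big_enum_cond /=.
by rewrite sum1_card; apply: eq_card => l; rewrite inE.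
Qed.

Section SumOverMiddleWords.
Variables (r k : nat) (D : finType) (a b d : wcomp r k).
Variables (f h : {ffun 'I_r -> D}) (G : mspart 3 r k).
Local Notation T3 g := (word_type (trip a b d) (word3 f g h)).
Local Notation T2 := (word_type (pair2 a d) (word2 f h)).
Local Notation L := 'I_(size (mblocks G)).

(** Blocks are indexed by position, so equal blocks remain distinct labels. *)
Let C (l : L) := tnth (in_tuple (mblocks G)) l.

Let labels_C : mblocks G = seq_mset [seq C l | l <- enum L].
Proof. by rewrite map_tnth_enum /= seq_mset_id. Qed.

(** The letter counts that the middle word must have once block [l] receives colour [e l]. *)
Let mid (e : {ffun L -> D}) c j := (\sum_(l | e l == c) C l (row1, j))%N.

Let big_C (R : Type) (idx : R) (op : Monoid.com_law idx) (P : {mset _} -> R) :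
  \big[op/idx]_(B <- mblocks G) P B = \big[op/idx]_l P (C l).
Proof. by rewrite {1}labels_C (perm_big _ (perm_eq_seq_mset _)) big_map big_enum. Qed.

Let mid_inj (e : {ffun L -> D}) l j : injective e -> mid e (e l) j = C l (row1, j).
Proof.
move=> I; rewrite /mid (big_pred1 l) // => l'; exact: inj_eq.
Qed.

Let mid0 (e : {ffun L -> D}) c j : c \notin codom e -> mid e c j = 0%N.
Proof.
move=> ce; rewrite /mid big1 // => l /eqP E; case/negP: ce; rewrite -E; exact: codom_f.
Qed.

Let cell_row1 (g : {ffun 'I_r -> D}) c j :
  cell (trip a b d) (word3 f g h) c (row1, j) = fibre_card b g c j.
Proof. exact: cell_row. Qed.

Let drop_cell (g : {ffun 'I_r -> D}) c : drop_block row1 (cell (trip a b d) (word3 f g h) c) =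
  cell (pair2 a d) (word2 f h) c.
Proof.
rewrite drop_block_cell; apply/msetP => -[i j]; rewrite !cellE.
apply: eq_card => t; rewrite !inE.
by have [->|/eq_bar ->] := eqVneq i unb.
Qed.

(** Separates the dependence on the middle word: the labelling condition on the outer rows does not
    involve [g], and the rest only fixes the counts of [g]. *)
Let inj_over_split (e : {ffun L -> D}) (g : {ffun 'I_r -> D}) :
  inj_over (cell (trip a b d) (word3 f g h)) C e =
  inj_over (cell (pair2 a d) (word2 f h)) (fun l => drop_block row1 (C l)) e &&
  fits b (mid e) g.
Proof.
apply/idP/andP => [H|[/inj_overP [I H] /fitsP K]].
  have /inj_overP [I E] := H; split.
    by apply/inj_overP; split=> // l; rewrite -E drop_cell.
  apply/fitsP => c j; rewrite -cell_row1.
  have [/codomP [l ->]|ce] := boolP (c \in codom e); first by rewrite E mid_inj.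
  by rewrite (labelling_cell0 labels_C H ce) mset0E mid0.
apply/inj_overP; split=> // l; apply/msetP => -[i j].
case: (unliftP row1 i) => [i'|] ->; last by rewrite cell_row1 K mid_inj.
apply: etrans (esym (drop_blockE row1 _ (i', j))) (etrans _ (drop_blockE row1 _ (i', j))).
by rewrite drop_cell H.
Qed.

Hypothesis GT : drop_row row1 G = T2.
Hypothesis Gb : b = content bar (drop_row row2 G).

Let sum_mid (e : {ffun L -> D}) j :
  (\sum_c mid e c j)%N = #|[pred t | interval b t == j]|.
Proof.
by rewrite Gb -content_row1 big_C [RHS](partition_big e predT).
Qed.

Let prod_mid (e : {ffun L -> D}) : injective e ->
  (\prod_c \prod_j (mid e c j)`! = rowfact row1 G)%N.
Proof.
move=> I; rewrite /rowfact big_C (bigID (mem (e @: predT))) /= [X in (_ * X)%N]big1 ?muln1.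
  rewrite big_imset /=; last by move=> l l' _ _; exact: I.
  by apply: eq_bigr => l _; apply: eq_bigr => j _; rewrite mid_inj.
move=> c ce; rewrite big1 // => j _; rewrite mid0 //.
by apply: contra ce => /codomP [l ->]; exact: imset_f.
Qed.

(** Double count of the pairs of a middle word and a labelling. For fixed [e], [card_fits] counts
    the words; [card_inj_over] then counts the admissible [e]. *)
Lemma sum_middle_words :
  ((\sum_(g : {ffun 'I_r -> D}) (G == T3 g)) * mfact (mblocks G) * rowfact row1 G =
   #|young b| * ((#|D| - #|outer f h|) ^_ size (middle_blocks G) *
     \prod_(S <- undup (mblocks (drop_row row1 G))) (size (fibre G S))`!))%N.
Proof.
rewrite big_distrl /=.
under eq_bigr => g _ do rewrite -(card_labellings (trip a b d) (word3 f g h) labels_C).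
rewrite exchange_big big_distrl /=.
pose dC l := drop_block row1 (C l).
transitivity (\sum_(e : {ffun L -> D}) #|young b| *
   inj_over (cell (pair2 a d) (word2 f h)) dC e)%N.
  apply: eq_bigr => e _; under eq_bigr do rewrite inj_over_split -mulnb.
  rewrite -big_distrr /= sum_bool_card.
  have [/inj_overP [I _]|_] := boolP (inj_over _ _ _); last by rewrite mul0n muln0.
  by rewrite mul1n muln1 -(card_fits (sum_mid e)) (prod_mid I).
rewrite -big_distrr; congr (_ * _)%N.
have us := uniq_drop_row G.
rewrite (card_inj_over _ us) => [|l]; last exact/middle_or_drop/mem_tnth.
rewrite big_cons; congr (_ * _)%N.
  (* Purely barred blocks need distinct colours with an empty outer cell, that is, colours outside
     the outer words. *)
  rewrite size_middle_blocks -card_tnth_count; congr (_ ^_ _)%N.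
  rewrite /outer -(cardC (mem (codom (word2 f h)))) cardsE addKn.
  by apply: eq_card => c; rewrite !inE -(cell_neq0 (pair2 a d)) negbK.
apply: eq_big_seq => S; rewrite mem_undup => SG.
have S0 := mspart_neq0 SG.
rewrite size_fibre -card_tnth_count -[X in X ^_ _](type_mult _ _ S0).
(* By [GT] there are as many colours with outer cell [S] as blocks restricting to [S], so the
   falling factorial is a factorial. *)
rewrite -GT drop_row_mult // -card_tnth_count ffactnn //.
Qed.

End SumOverMiddleWords.

Lemma mfact_gt0 (K : choiceType) (M : {mset K}) : (0 < mfact M)%N.
Proof. by apply: prodn_gt0 => y; exact: fact_gt0. Qed.

Section WeightedSums.
Variables (r k : nat) (D : finType).

Lemma count_type (m : nat) (A : 'I_m -> wcomp r k) (w : 'I_m * 'I_r -> D) P :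
  count P (mblocks (word_type A w)) = #|[pred c | (c \in codom w) && P (cell A w c)]|.
Proof.
rewrite (seq.permP (perm_eq_seq_mset _)) count_filter count_map -sum1_count.
rewrite big_enum_cond /= sum1_card; apply: eq_card => c.
by rewrite [LHS]unfold_in /= cell_neq0 inE andbC.
Qed.

Variables (a b d : wcomp r k) (f h : {ffun 'I_r -> D}).

(** Hence the weight is constant on the middle words that yield a given type. *)
Lemma new_colours_middle (g : {ffun 'I_r -> D}) :
  new_colours (outer f h) g = size (middle_blocks (word_type (trip a b d) (word3 f g h))).
Proof.
rewrite size_middle_blocks count_type /new_colours -sum1_card -[RHS]sum1_card; apply: eq_bigl => c.
rewrite !inE drop_block_cell.
have -> : cell (fun i => trip a b d (lift row1 i)) (fun v => word3 f g h (lift row1 v.1, v.2)) c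
    = cell (pair2 a d) (word2 f h) c.
  apply/msetP => -[i j]; rewrite !cellE; apply: eq_card => t; rewrite !inE.
  by have [->|/eq_bar ->] := eqVneq i unb.
rewrite -[_ == mset0]negbK cell_neq0.
have [|nc] := boolP (c \in codom (word2 f h)); rewrite ?andbF ?andbT //.
apply/codomP/codomP => [[i ->]|[[i t] E]]; first by exists (row1, i).
have [/eqP i1|im] := boolP (i == row1); first by exists t; rewrite E i1.
have [u U] : {u | (i, t) = place row1 u} by apply: outer_place; rewrite inE.
by case/negP: nc; rewrite E U word3_place1 codom_f.
Qed.

Variables (F : fieldType) (x : F).
Hypothesis char0 : forall n, n.+1%:R != 0 :> F.
Hypothesis rD : (3 * r <= #|D|)%N.

Lemma natr_neq0 n : (0 < n)%N -> n%:R != 0 :> F.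
Proof. by case: n. Qed.

Lemma rowfact_neq0 m (i : 'I_m) (P : mspart m r k) : (rowfact i P)%:R != 0 :> F.
Proof.
by apply: natr_neq0; apply: prodn_gt0 => B; apply: prodn_gt0 => j; exact: fact_gt0.
Qed.

Lemma young_neq0 (c : wcomp r k) : #|young c|%:R != 0 :> F.
Proof.
apply: natr_neq0; apply/card_gt0P; exists 1%g; rewrite inE.
by apply/forallP => i; rewrite perm1.
Qed.

Lemma falling_nat n m : falling (n%:R : F) m = (n ^_ m)%:R.
Proof.
elim: m => [|m IH]; first by rewrite /falling big_ord0 ffactn0.
rewrite fallingS IH ffactnSr natrM; have [mn|nm] := leqP m n; first by rewrite natrB.
by rewrite ffact_small // !mul0r.
Qed.

(** The denominator of the constant weight cancels the falling factorial in [sum_middle_words], and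
    its numerator is that of b_G. The remaining factorials give a_G and the denominator of b_G. *)
Lemma sum_wt_type (G : mspart 3 r k) :
  \sum_(g : {ffun 'I_r -> D}) wt x (outer f h) (new_colours (outer f h) g) *
    ((G == word_type (trip a b d) (word3 f g h))%:R * (rowfact row1 G)%:R) =
  (drop_row row1 G == word_type (pair2 a d) (word2 f h))%:R *
  (b == content bar (drop_row row2 G))%:R *
  (acoef F G * bcoef x G * #|young b|%:R).
Proof.
have [GT|GT] := eqVneq (drop_row row1 G) _; last first.
  rewrite !mul0r big1 // => g _; case: eqP => [E|]; last by rewrite mul0r mulr0.
  by case/eqP: GT; rewrite E type_row1.
have [Gb|Gb] := eqVneq b _; last first.
  rewrite mulr0 mul0r big1 // => g _; case: eqP => [E|]; last by rewrite mul0r mulr0.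
  by case/eqP: Gb; rewrite E type_row2 content_type.
rewrite !mul1r.
rewrite (eq_bigr (fun g : {ffun 'I_r -> D} =>
    wt x (outer f h) (size (middle_blocks G)) * (rowfact row1 G)%:R *
    (G == word_type (trip a b d) (word3 f g h))%:R)); last first.
  move=> g _; case: eqP => [E|]; last by rewrite mul0r !mulr0.
  by rewrite new_colours_middle -E mul1r mulr1.
rewrite -big_distrr -natr_sum /=.
have := congr1 (fun n => n%:R : F) (sum_middle_words GT Gb).
rewrite mfact_fibres !natrM; set N := (\sum_g _)%N.
have lD : (#|outer f h| + size (middle_blocks G) <= #|D|)%N.
  apply: leq_trans rD; rewrite mulSn addnC leq_add ?card_outer //; exact: size_middle_leq.
have lO : (#|outer f h| <= #|D|)%N by apply: leq_trans lD; exact: leq_addr.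
have -> : acoef F G = (\prod_(S <- undup (mblocks (drop_row row1 G))) (size (fibre G S))`!)%N%:R /
    (\prod_(S <- undup (mblocks (drop_row row1 G))) mfact (fibre G S))%N%:R.
  by rewrite /acoef prodf_div !natr_prod.
rewrite /bcoef /wt -natrB // falling_nat.
have -> : size (mblocks (drop_row row1 G)) = #|outer f h| by rewrite GT size_type.
have Q0 : ((#|D| - #|outer f h|) ^_ size (middle_blocks G))%:R != 0 :> F.
  by apply: natr_neq0; rewrite ffact_gt0 leq_subRL.
have M0 : (mfact (middle_blocks G))%:R != 0 :> F by apply: natr_neq0; exact: mfact_gt0.
have R0 := rowfact_neq0 row1 G.
have A0 : (\prod_(S <- undup (mblocks (drop_row row1 G))) mfact (fibre G S))%:R != 0 :> F.
  by apply: natr_neq0; apply: prodn_gt0 => S; exact: mfact_gt0.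
move: Q0 M0 R0 A0.
set Q := (_ ^_ _)%:R; set M := (mfact (middle_blocks G))%:R; set R := (rowfact _ _)%:R.
set A := (\prod_(S <- _) (mfact _))%:R; set A' := (\prod_(S <- _) _)%:R; set W := falling _ _.
move=> Q0 M0 R0 A0 E.
have -> : N%:R = #|young b|%:R * (Q * A') / (M * A * R).
  have <- : N%:R * (M * A) * R = #|young b|%:R * (Q * A') := E.
  by rewrite -[N%:R * _ * _]mulrA mulfK // !mulf_neq0.
by field; rewrite Q0 M0 R0 A0.
Qed.

End WeightedSums.

(** * The isomorphism *)

Section Isomorphism.
Variables (F : fieldType) (x : F) (r k : nat).
Hypothesis char0 : forall n, n.+1%:R != 0 :> F.
Hypothesis r_gt0 : (0 < r)%N.
Local Notation D := ('I_3 * 'I_r)%type.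
Local Notation word := {ffun 'I_r -> D}.

Let rD : (3 * r <= #|{: D}|)%N.
Proof. by rewrite card_prod !card_ord. Qed.

Let d0 : D := (row1, Ordinal r_gt0).

(** With 2r letters and no empty block, [pt] has at most 2r blocks, so they can be given distinct
    colours; [fits_exists] then builds each row from the resulting counts. *)
Lemma type_onto (pt : mspart 2 r k) : exists fh : word * word,
  word_type (pair2 (content unb pt) (content bar pt)) (word2 fh.1 fh.2) == pt.
Proof.
set L := 'I_(size (mblocks pt)).
pose C (l : L) := tnth (in_tuple (mblocks pt)) l.
have labels_C : mblocks pt = seq_mset [seq C l | l <- enum L].
  by rewrite map_tnth_enum /= seq_mset_id.
have [e I] : exists e : L -> D, injective e.
  apply: exists_injection; rewrite card_ord; apply: leq_trans rD.
  apply: (@leq_trans (2 * r)); last by rewrite leq_mul2r orbT.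
  rewrite -(MSPartFinite.mspart_size pt) -sum1_size big_seq [leqRHS]big_seq.
  apply: leq_sum => B BP; rewrite lt0n; apply: contraNneq (mspart_neq0 BP) => /size0nil Bn.
  by rewrite -(seq_mset_id B) Bn; apply/eqP/msetP => l; rewrite mset_seqE mset0E.
pose n i c j := (\sum_(l | e l == c) C l (i, j))%N.
have n_e i l j : n i (e l) j = C l (i, j).
  by rewrite /n (big_pred1 l) // => l'; exact: inj_eq.
have [g G] : exists g : 'I_2 -> word, forall i, fits (content i pt) (n i) (g i).
  apply: (@fin_all_exists _ _ (fun i g => fits (content i pt) (n i) g)) => i.
  apply: fits_exists => j; transitivity (\sum_l C l (i, j))%N.
    by rewrite [RHS](partition_big e predT).
  rewrite card_interval /= tnth_mktuple inordK; last first.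
    by rewrite ltnS -[leqRHS](sum_multiplicity i pt) (bigD1 j) //= leq_addr.
  rewrite /multiplicity [in RHS]labels_C (perm_big _ (perm_eq_seq_mset _)) big_map big_enum.
  by [].
exists (g unb, g bar); apply/eqP/esym; apply: (labelling_type labels_C (e := finfun e)).
apply/inj_overP; split=> [l l'|l]; first by rewrite !ffunE => /I.
rewrite ffunE; apply/msetP => -[i j].
have [->|/eq_bar ->] := eqVneq i unb.
  by rewrite (@cell_row 2 r k _ _ _ (g unb)) //= (fitsP _ _ _ (G unb)) n_e.
by rewrite (@cell_row 2 r k _ _ _ (g bar)) //= (fitsP _ _ _ (G bar)) n_e.
Qed.

Definition rep pt : word * word := xchoose (type_onto pt).

Lemma repP pt :
  word_type (pair2 (content unb pt) (content bar pt)) (word2 (rep pt).1 (rep pt).2) = pt.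
Proof. exact/eqP/(xchooseP (type_onto pt)). Qed.

Definition rep_part pt : setpart r := kerpart (word2 (rep pt).1 (rep pt).2).

Lemma kappa_rep pt : kappa (content unb pt) (content bar pt) (rep_part pt) = pt.
Proof. by rewrite kappa_type repP. Qed.

(** The scalar is chosen so that the value in [rho_sandwich_orbit] becomes omega. *)
Definition phi (u : ptilde r k x) : mpalg r k F := [ffun pt =>
  #|young (content bar pt)|%:R / (rowfact unb pt)%:R *
  rho (rep pt).1 (rep pt).2 (u (content unb pt, content bar pt)) : F^o].

Fact phi_linear : linear phi.
Proof.
move=> c u v; apply/ffunP => pt; rewrite !ffunE linearP /=.
by rewrite mulrDr [X in X + _]mulrCA.
Qed.
HB.instance Definition _ := GRing.isLinear.Build F (ptilde r k x) (mpalg r k F) _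
  phi phi_linear.

Lemma rho_corner (a b : wcomp r k) (u : partalg x r) (f h f' h' : word) :
  u \in @corner r k F x a b ->
  word_type (pair2 a b) (word2 f h) = word_type (pair2 a b) (word2 f' h') ->
  rho f h u = rho f' h' u.
Proof.
case/cornerP => v -> E; rewrite -[_ * _ * _]/(sandwich a b v) [v]orbit_expand !linear_sum.
apply: eq_bigr => p _; rewrite !linearZ /=; congr (_ * _).
by rewrite /sandwich !(rho_sandwich_orbit x d0 char0 rD) E.
Qed.

(** By [rho_corner] the choice of [rep] is immaterial, so [phi u] determines every matrix entry of
    every component of [u]. *)
Lemma phiE (u : ptilde r k x) a b (f h : word) :
  let T := word_type (pair2 a b) (word2 f h) in
  rho f h (u (a, b)) = (rowfact unb T)%:R / #|young b|%:R * phi u T.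
Proof.
move=> T; rewrite ffunE; have := repP T; have := ptilde_corner u a b.
rewrite !content_type /= => uab E; rewrite (rho_corner uab (esym E)).
rewrite mulrA mulrA divfK ?(young_neq0 char0) // divff ?mul1r //.
exact: (rowfact_neq0 char0).
Qed.

Lemma phi_orbit : maps_orbit_basis phi.
Proof.
move=> pt p kp; apply/ffunP => pt'; rewrite !ffunE /=.
case: eqP => [E|N]; last first.
  rewrite linear0 mulr0; case: eqP => [E|_]; last by rewrite scaler0.
  by case: N; rewrite E.
have /= E1 := congr1 fst E; have /= E2 := congr1 snd E.
rewrite (rho_sandwich_orbit x d0 char0 rD) -E1 -E2 repP E1 E2 kp eq_sym omegaE.
case: eqP => [->|_]; last by rewrite !mul0r mulr0 scaler0.
have Ya := young_neq0 char0 (content unb pt'); have Yb := young_neq0 char0 (content bar pt').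
have R0 := rowfact_neq0 char0 unb pt.
rewrite /GRing.scale /= -E1 -E2 !natrM; field.
by rewrite Ya Yb R0.
Qed.

Lemma omega_neq0 (pt : mspart 2 r k) : omega F pt != 0.
Proof.
rewrite omegaE !mulf_neq0 ?invr_eq0 ?(young_neq0 char0) ?(rowfact_neq0 char0) //.
by apply: (natr_neq0 char0); exact: mfact_gt0.
Qed.

Definition phi_inv (v : mpalg r k F) : ptilde r k x :=
  \sum_pt (v pt / omega F pt : F) *: orbit_like x pt (rep_part pt).

Lemma mpbasis_expand (v : mpalg r k F) : v = \sum_pt (v pt : F) *: mpbasis F pt.
Proof.
apply/ffunP => pt; rewrite sum_ffunE (bigD1 pt) //= big1 => [|pt' N].
  by rewrite !ffunE eqxx addr0 /GRing.scale /= mulr1.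
by rewrite !ffunE eq_sym (negbTE N) scaler0.
Qed.

(** Stated for an arbitrary [psi]: since [phi_inv] is also a left inverse of [phi], this yields
    uniqueness as well as bijectivity. *)
Lemma orbit_basis_inv (psi : {linear ptilde r k x -> mpalg r k F}) :
  maps_orbit_basis psi -> cancel phi_inv psi.
Proof.
move=> H v; rewrite [RHS]mpbasis_expand linear_sum; apply: eq_bigr => pt _.
by rewrite linearZ /= (H _ _ (kappa_rep pt)) scalerA divfK ?omega_neq0.
Qed.

Lemma phi_inj : injective phi.
Proof.
move=> u v E; apply: val_inj; apply/ffunP => -[a b] /=.
by apply: (rho_inj rD) => f h; rewrite !phiE E.
Qed.

Lemma phiK : cancel phi phi_inv.
Proof. by move=> u; apply: phi_inj; rewrite (orbit_basis_inv phi_orbit). Qed.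

(** Each [G] is an overlay of exactly one pair, namely its own two restrictions, so the sums over
    pairs collapse. *)
Lemma mp_mulE (u v : mpalg r k F) pt :
  mp_mul x u v pt = \sum_(G | drop_row row1 G == pt)
    (u (drop_row row2 G) * v (drop_row row0 G)) * (acoef F G * bcoef x G).
Proof.
rewrite /mp_mul sum_ffunE.
pose t p1 p2 G : F := if G \in overlays p1 p2 then
  u p1 * v p2 * (acoef F G * bcoef x G) * (drop_row row1 G == pt)%:R else 0.
transitivity (\sum_p1 \sum_p2 \sum_G t p1 p2 G).
  apply: eq_bigr => p1 _; rewrite sum_ffunE; apply: eq_bigr => p2 _.
  rewrite ffunE sum_ffunE scaler_sumr [LHS]big_mkcond; apply: eq_bigr => G _; rewrite /t.
  by case: ifP => // _; rewrite !ffunE eq_sym /GRing.scale /= mulrA.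
transitivity (\sum_p1 \sum_G \sum_p2 t p1 p2 G).
  by apply: eq_bigr => p1 _; exact: exchange_big.
rewrite exchange_big [RHS]big_mkcond /=; apply: eq_bigr => G _.
rewrite (bigD1 (drop_row row2 G)) //= [X in _ + X]big1 => [|p1 N]; last first.
  by rewrite big1 // => p2 _; rewrite /t inE eq_sym (negbTE N).
rewrite addr0 (bigD1 (drop_row row0 G)) //= [X in _ + X]big1 => [|p2 N]; last first.
  by rewrite /t inE eqxx eq_sym (negbTE N).
by rewrite /t inE !eqxx addr0; case: ifP; rewrite ?mulr1 ?mulr0.
Qed.

(** Expand the entry of the product over middle words, sort these by the type G of (f, g, h), and
    evaluate each class with [sum_wt_type]. *)
Lemma phi_mul : {morph phi : u v / ptilde_mul u v >-> mp_mul x u v}.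
Proof.
move=> u v; apply/ffunP => pt; rewrite mp_mulE ffunE ffunE /= linear_sum /=.
set f := (rep pt).1; set h := (rep pt).2; set a := content unb pt; set d := content bar pt.
have T : word_type (pair2 a d) (word2 f h) = pt by exact: repP.
pose t b (g : word) G := wt x (outer f h) (new_colours (outer f h) g) *
  ((G == word_type (trip a b d) (word3 f g h))%:R * (rowfact row1 G)%:R).
pose c G := phi u (drop_row row2 G) * phi v (drop_row row0 G) : F.
have step b : rho f h (u (a, b) * v (b, d)) =
    (rowfact unb pt)%:R / #|young d|%:R *
    (\sum_G c G * (\sum_(g : word) t b g G) / #|young b|%:R).
  rewrite (rhoM char0 rD d0) mulr_sumr.
  transitivity (\sum_(g : word) \sum_G (rowfact unb pt)%:R / #|young d|%:R *
      (c G * t b g G / #|young b|%:R)); last first.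
    rewrite exchange_big; apply: eq_bigr => G _ /=.
    by rewrite mulr_sumr mulr_suml mulr_sumr.
  apply: eq_bigr => g _; set T3 := word_type (trip a b d) (word3 f g h).
  (* The indicator in [t] makes the sum over G a single term, at the type of (f, g, h). *)
  rewrite (bigD1 T3) //= big1 => [|G N]; last first.
    by rewrite /t (negbTE N) mul0r !mulr0 mul0r mulr0.
  rewrite addr0 !phiE /c /t eqxx mul1r type_row2 type_row0.
  have -> : rowfact unb (word_type (pair2 a b) (word2 f g)) = rowfact unb pt.
    by rewrite -T !(@rowfact_type 2 r k _ _ _ f unb).
  (* The unbarred word of the second factor is the middle word [g] of the triple. *)
  have -> : rowfact unb (word_type (pair2 b d) (word2 g h)) = rowfact row1 T3.
    by rewrite (@rowfact_type 2 r k _ _ _ g unb) ?(@rowfact_type 3 r k _ _ _ g row1).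
  by ring.
rewrite (eq_bigr _ (fun b _ => step b)) -mulr_sumr mulrA.
rewrite [X in X * _](_ : _ = 1) ?mul1r; last first.
  have := young_neq0 char0 d; have := rowfact_neq0 char0 unb pt => R0 Y0.
  by field; rewrite R0 Y0.
rewrite exchange_big [RHS]big_mkcond; apply: eq_bigr => G _ /=.
under eq_bigr do rewrite (@sum_wt_type _ _ _ _ _ _ _ _ _ x char0 rD G) T.
case: eqP => [GT|_]; last by rewrite big1 // => b _; rewrite !mul0r mulr0 mul0r.
(* A given G fixes the content of its middle row, so a single intermediate corner [b]
   contributes. *)
rewrite (bigD1 (content bar (drop_row row2 G))) //= big1 => [|b /negbTE ->]; last first.
  by rewrite mulr0 !mul0r mulr0 mul0r.
by rewrite eqxx !mul1r addr0 !mulrA mulfK ?(young_neq0 char0).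
Qed.

Lemma ptilde_oneE a b :
  ptilde_one r k x (a, b) = if a == b then symmetrizer x a else 0.
Proof.
have -> : pcomp (ptilde_one r k x) = \sum_c pcomp (corner_elt c c (1 : partalg x r)).
  exact: (raddf_sum (\val : ptilde r k x -> _)).
rewrite sum_ffunE (bigD1 a) //= big1 => [|c /negbTE N].
  rewrite ffunE addr0 xpair_eqE eqxx eq_sym mulr1.
  by case: eqP => // _; exact: symmetrizer_idem (young_neq0 char0 a).
by rewrite ffunE xpair_eqE [a == c]eq_sym N.
Qed.

Lemma ptilde_mul1l : left_id (ptilde_one r k x) (@ptilde_mul r k F x).
Proof.
move=> u; apply: val_inj; apply/ffunP => -[a b]; rewrite ffunE /=.
rewrite (bigD1 a) //= big1 => [|c /negbTE N]; last by rewrite ptilde_oneE eq_sym N mul0r.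
rewrite addr0 ptilde_oneE eqxx; have /cornerP [v ->] := ptilde_corner u a b.
by rewrite !mulrA symmetrizer_idem // (young_neq0 char0).
Qed.

Lemma ptilde_mul1r : right_id (ptilde_one r k x) (@ptilde_mul r k F x).
Proof.
move=> u; apply: val_inj; apply/ffunP => -[a b]; rewrite ffunE /=.
rewrite (bigD1 b) //= big1 => [|c /negbTE N]; last by rewrite ptilde_oneE N mulr0.
rewrite addr0 ptilde_oneE eqxx; have /cornerP [v ->] := ptilde_corner u a b.
by rewrite -!mulrA symmetrizer_idem // (young_neq0 char0).
Qed.

Lemma orbit_basis_unique (psi : {linear ptilde r k x -> mpalg r k F}) :
  maps_orbit_basis psi -> psi =1 phi.
Proof. by move=> H u; rewrite -{1}[u]phiK (orbit_basis_inv H). Qed.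

(** The unit laws in the target are transported through [phi]: each [v] is the image of [phi_inv v],
    and [phi] respects products. *)
Lemma phi_alg_iso :
  alg_iso (@ptilde_mul r k F x) (ptilde_one r k x) (@mp_mul r k F x) phi.
Proof.
have K := orbit_basis_inv phi_orbit; split; first by exists phi_inv; [exact: phiK|].
  exact: phi_mul.
by split=> v; rewrite -[v]K -phi_mul ?ptilde_mul1l ?ptilde_mul1r.
Qed.

End Isomorphism.

Theorem theorem8p1 (R : realType) (r k : nat) (hr : (0 < r)%N) (hk : (0 < k)%N) :
  exists phi : {linear ptilde r k (indet R) -> mpalg r k (ratfun R)},
    [/\ maps_orbit_basis phi,
        forall psi : {linear ptilde r k (indet R) -> mpalg r k (ratfun R)},
          maps_orbit_basis psi -> psi =1 phi
      & alg_iso (@ptilde_mul r k (ratfun R) (indet R))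
                (ptilde_one r k (indet R))
                (@mp_mul r k (ratfun R) (indet R))
                phi].
Proof.
have char0 n : n.+1%:R != 0 :> ratfun R.
  (* Nonzero integers stay nonzero from the complex numbers to constant polynomials to fractions. *)
  rewrite -(rmorph_nat (@tofrac {poly R[i]})) tofrac_eq0 -polyC_natr polyC_eq0.
  by rewrite Num.Theory.pnatr_eq0.
exists (@phi (ratfun R) (indet R) r k); split.
- exact: phi_orbit.
- by move=> psi; exact: orbit_basis_unique.
- exact: phi_alg_iso.
Qed.
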